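(* Every B-tiling of the hyperbolic plane $\mathbb H^2$ is non-crystallographic.
   Context: Fix $w>0$. In the upper half-plane model $\mathbb H^2=\{(x,y): y>0\}$ with metric $(dx^2+dy^2)/y^2$, the Böröczky pentagon is $B=\{(x,y): 0\le x\le w,\ \tfrac12\le y\le 1\}$, i.e. a region between two concentric horocycles at distance $\ln 2$ and two lines through their common ideal point. It is regarded as a pentagon with edges: the $a$-edge (the side $y=1$), the $b_1$-edge and $b_2$-edge (the halves $0\le x\le w/2$ and $w/2\le x\le w$ of the side $y=\tfrac12$), and two $c$-edges (the sides $x=0$ and $x=w$); its vertices are the five endpoints of these edges. Each $c$-edge is oriented from the $a$-edge towards the $b$-edges. A B-tiling is a tiling of $\mathbb H^2$ by isometric copies of $B$ that is edge-to-edge (every non-empty intersection of two distinct tiles is a common edge or a common vertex) and respects orientations of $c$-edges (if two tiles share a $c$-edge, the two induced orientations agree). A tiling is crystallographic if its symmetry group (the group of all isometries mapping the tiling to itself) has a compact fundamental domain. *)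

(* Defs.v *)
From mathcomp Require Import all_boot all_order all_algebra.
From mathcomp Require Import all_classical all_reals all_analysis.
Set Implicit Arguments.
Unset Strict Implicit.
Unset Printing Implicit Defensive.
Import Order.TTheory GRing.Theory Num.Theory.
Import numFieldNormedType.Exports.
Local Open Scope classical_set_scope.
Local Open Scope ring_scope.

Section HyperbolicPlane.
Context {R : realType}.
Implicit Types (p q : R * R) (x y : R -> R) (f : R * R -> R * R).

(* H2 is open in R * R, so compactness and interiors of its subsets may be    *)
(* taken in R * R.                                                            *)
Definition H2 : set (R * R) := [set p | 0 < p.2].

(* Every C^1 curve on [0, 1] extends to a C^1 curve on R, so it is enough to  *)
(* consider the latter; only the values on [0, 1] must lie in H2.             *)
Definition C1_path_in_H2 x y p q : Prop :=
  [/\ (forall t : R, derivable x t 1) /\ continuous (derive1 x),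
      (forall t : R, derivable y t 1) /\ continuous (derive1 y),
      (forall t : R, 0 <= t <= 1 -> H2 (x t, y t)),
      (x 0, y 0) = p & (x 1, y 1) = q].

Definition hyp_length x y : R :=
  \int[lebesgue_measure]_(t in `[0, 1])
    (Num.sqrt ((derive1 x t) ^+ 2 + (derive1 y t) ^+ 2) / y t).

(* The distance induced by the Riemannian metric (dx^2 + dy^2) / y^2.         *)
Definition hyp_dist p q : R :=
  inf [set l : R | exists x y : R -> R,
                     C1_path_in_H2 x y p q /\ l = hyp_length x y].

(* Isometries of H2 are represented by maps of R * R; only their values on    *)
(* H2 are meaningful.                                                         *)
Definition hyp_isometry f : Prop :=
  set_bij H2 H2 f /\
  (forall p q, H2 p -> H2 q -> hyp_dist (f p) (f q) = hyp_dist p q).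

(* Elements of G are identified when they agree on H2.                        *)
Definition fundamental_domain (G : set (R * R -> R * R)) (F : set (R * R)) :
    Prop :=
  [/\ F `<=` H2,
      closure F `&` H2 `<=` F,
      \bigcup_(g in G) (g @` F) = H2 &
      forall g h, G g -> G h -> ~ (forall p, H2 p -> g p = h p) ->
        (g @` F°) `&` (h @` F°) = set0].

End HyperbolicPlane.

Section BoroczkyPentagon.
Context {R : realType}.
Implicit Types (w : R) (T E : set (R * R)) (TT : set (set (R * R))).

Definition pentagon w : set (R * R) :=
  [set p | 0 <= p.1 <= w /\ 2^-1 <= p.2 <= 1].

Definition a_edge w : set (R * R) := [set p | 0 <= p.1 <= w /\ p.2 = 1].
Definition b1_edge w : set (R * R) :=
  [set p | 0 <= p.1 <= w / 2 /\ p.2 = 2^-1].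
Definition b2_edge w : set (R * R) :=
  [set p | w / 2 <= p.1 <= w /\ p.2 = 2^-1].
Definition c_edge (x0 : R) : set (R * R) :=
  [set p | p.1 = x0 /\ 2^-1 <= p.2 <= 1].

Definition pentagon_edges w : set (set (R * R)) :=
  [set a_edge w; b1_edge w; b2_edge w; c_edge 0; c_edge w].

Definition pentagon_vertices w : set (R * R) :=
  [set (0, 1); (w, 1); (0, 2^-1); (w / 2, 2^-1); (w, 2^-1)].

(* [pentagon_oriented_c_edge w e s t]: the c-edge [e] is oriented from its    *)
(* endpoint [s] on the a-edge to its endpoint [t] on a b-edge.                *)
Definition pentagon_oriented_c_edge w (e : set (R * R)) (s t : R * R) : Prop :=
  [/\ e = c_edge 0, s = (0, 1) & t = (0, 2^-1)] \/
  [/\ e = c_edge w, s = (w, 1) & t = (w, 2^-1)].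

Definition tile w T : Prop :=
  exists f, hyp_isometry f /\ T = f @` pentagon w.

(* A tile is a set of points, and its edges, vertices and orientations are    *)
(* carried over by an isometry from the pentagon.  The isometry is not unique *)
(* because of the reflection x |-> w - x, which however preserves the set of  *)
(* edges, the set of vertices and the orientations of the c-edges.            *)
Definition tile_edge w T E : Prop :=
  exists f e, [/\ hyp_isometry f, T = f @` pentagon w,
                  pentagon_edges w e & E = f @` e].

Definition tile_vertex w T (v : R * R) : Prop :=
  exists f u, [/\ hyp_isometry f, T = f @` pentagon w,
                  pentagon_vertices w u & v = f u].

Definition tile_oriented_c_edge w T E (s t : R * R) : Prop :=
  exists f e s0 t0,
    [/\ hyp_isometry f, T = f @` pentagon w,
        pentagon_oriented_c_edge w e s0 t0, E = f @` e & (s, t) = (f s0, f t0)].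

Definition tiling_by_pentagons w TT : Prop :=
  [/\ forall T, TT T -> tile w T,
      \bigcup_(T in TT) T = H2 &
      forall T T', TT T -> TT T' -> T <> T' -> T° `&` T'° = set0].

Definition edge_to_edge w TT : Prop :=
  forall T T', TT T -> TT T' -> T <> T' -> T `&` T' !=set0 ->
    (exists E, [/\ tile_edge w T E, tile_edge w T' E & T `&` T' = E]) \/
    (exists v, [/\ tile_vertex w T v, tile_vertex w T' v &
                   T `&` T' = [set v]]).

Definition respects_orientations w TT : Prop :=
  forall T T', TT T -> TT T' -> T <> T' ->
    forall E s t s' t', tile_oriented_c_edge w T E s t ->
      tile_oriented_c_edge w T' E s' t' -> s = s' /\ t = t'.

Definition B_tiling w TT : Prop :=
  [/\ tiling_by_pentagons w TT, edge_to_edge w TT &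
      respects_orientations w TT].

Definition symmetry_group TT : set (R * R -> R * R) :=
  [set f | hyp_isometry f /\ [set f @` T | T in TT] = TT].

Definition crystallographic TT : Prop :=
  exists F : set (R * R), fundamental_domain (symmetry_group TT) F /\ compact F.

End BoroczkyPentagon.

(* Main.v *)
(* Adjacent tiles see the same point at infinity: an isometry carrying an     *)
(* infinite part of a horocycle into the lines bounding the pentagon fixes    *)
(* infinity, since otherwise the image is a Euclidean circle; across a c-edge *)
(* the same follows from the orientation.  The vertices being countably many, *)
(* all tiles share one point at infinity, and in the coordinates of one tile  *)
(* every symmetry of the tiling is a similarity (x, y) |-> (s x + t, |s| y).  *)
(* A compact fundamental domain forces a contraction a to exist.  If h is any *)
(* symmetry, the similarities a^k h a^-k have the same s and bounded t, so by *)
(* local finiteness two of them coincide: h commutes with a power of a and    *)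
(* fixes the centre of a on the real line.  Then the orbit of a compact set   *)
(* stays within bounded distance of the geodesic from that centre to          *)
(* infinity, and cannot cover the plane.                                      *)
Require Import Defs.
From mathcomp Require Import all_boot all_order all_algebra finmap.
From mathcomp Require Import all_classical all_reals all_analysis.
From mathcomp Require Import ring lra.
Set Implicit Arguments.
Unset Strict Implicit.
Unset Printing Implicit Defensive.
Import Order.TTheory GRing.Theory Num.Theory.
Import numFieldNormedType.Exports.
Local Open Scope classical_set_scope.
Local Open Scope ring_scope.

(** * The hyperbolic distance *)

(** In group terms: the symmetries all fix one ideal point, and a discrete group fixing an ideal
    point and containing a contraction also fixes the other end of the contraction's axis; a group
    preserving a geodesic is not cocompact on the plane. The metric input is [cosh_hyp_dist]:
    potentials and explicit geodesics evaluate the infimum of lengths, so isometries preserve the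
    rational function [cosh2]. Rigidity comes from [horocycle_dichotomy]: an isometry either fixes
    infinity or sends the horocycles at infinity to Euclidean circles. Through it
    [shared_edge_same_infty] compares two neighbours, [all_tiles_same_infty] propagates the
    comparison along a segment, and [symmetry_acts_as] turns every symmetry into a similarity.
    Discreteness enters through [tiling_locally_finite], a packing estimate, and is used against the
    contraction in [symmetries_fix_center]; [not_crystallographic] then exhibits a point that no
    orbit of a compact set reaches. *)

Section Length.
Context {R : realType}.
Implicit Types (p q : R * R) (x y phi dphi : R -> R).

Definition speed x y (t : R) : R :=
  Num.sqrt ((derive1 x t) ^+ 2 + (derive1 y t) ^+ 2) / y t.

Lemma derivable_continuous_at x (t : R) : derivable x t 1 ->
  x @ t --> x t.
Proof. by move=> /derivable1_diffP/differentiable_continuous. Qed.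

Lemma cvg_sqr (T : Type) (F : set_system T) (FF : Filter F) (f : T -> R) (a : R) :
  f @ F --> a -> (fun u => f u ^+ 2) @ F --> a ^+ 2.
Proof.
rewrite (_ : (fun u => f u ^+ 2) = (fun u => f u * f u)).
  by move=> cf; rewrite expr2; exact: cvgM.
by apply/funext => u; rewrite expr2.
Qed.

Lemma speed_continuous x y p q : C1_path_in_H2 x y p q ->
  {within `[0, 1], continuous (speed x y)}.
Proof.
case=> -[dx cx] [dy cy] yp _ _.
apply: continuous_in_subspaceT => t; rewrite inE /= in_itv /= => t01.
apply: cvgM; last first.
  apply: cvgV; first by rewrite gt_eqF// (yp t t01).
  exact: derivable_continuous_at.
apply: (@continuous_comp _ _ _ (fun t => (derive1 x t) ^+ 2 + (derive1 y t) ^+ 2) Num.sqrt).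
  by apply: cvgD; apply: cvg_sqr; [exact: cx|exact: cy].
exact: sqrt_continuous.
Qed.

(** By the fundamental theorem of calculus the increment of [phi] is the integral of [dphi], which
    the speed dominates pointwise. *)
Lemma le_hyp_length x y p q phi dphi : C1_path_in_H2 x y p q ->
  (forall t : R, 0 <= t <= 1 -> is_derive t 1 phi (dphi t)) ->
  {within `[0, 1], continuous dphi} ->
  (forall t : R, 0 <= t <= 1 -> `|dphi t| <= speed x y t) ->
  `|phi 1 - phi 0| <= hyp_length x y.
Proof.
move=> xyP dP dc le.
have der (t : R) : 0 <= t <= 1 -> derivable phi t 1 by move=> /dP [].
have int (f : R -> R) : {within `[0, 1], continuous f} ->
  lebesgue_measure.-integrable `[0, 1] (EFin \o f).
  by move=> cf; apply: continuous_compact_integrable => //; exact: segment_compact.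
have -> : phi 1 - phi 0 = \int[lebesgue_measure]_(t in `[0, 1]) dphi t.
  rewrite /Rintegral (@continuous_FTC2 _ dphi phi 0 1)//.
  - split.
    + by move=> t; rewrite in_itv/= => /andP[t0 t1]; apply: der; rewrite !ltW.
    + apply: cvg_at_right_filter; apply: derivable_continuous_at; apply: der.
      by rewrite lexx ler01.
    + apply: cvg_at_left_filter; apply: derivable_continuous_at; apply: der.
      by rewrite lexx ler01.
  - move=> t; rewrite in_itv/= => /andP[t0 t1].
    by rewrite derive1E; have /dP [] : 0 <= t <= 1 by rewrite !ltW.
apply: le_trans (le_normr_Rintegral _ (int _ dc)) _ => //.
apply: le_Rintegral => //.
- apply: int => t; apply: continuous_comp; [exact: dc|exact: norm_continuous].
- exact/int/speed_continuous/xyP.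
Qed.

Lemma hyp_length_const_speed x y c : (forall t, speed x y t = c) ->
  hyp_length x y = c.
Proof.
move=> sc; rewrite /hyp_length (eq_Rintegral _ (g := fun=> c)); last first.
  by move=> t _; exact: sc.
by rewrite Rintegral_cst//= lebesgue_measure_itv/= lte_fin ltr01 sube0/= mulr1.
Qed.

(* A potential [L] with hyperbolic gradient norm at most 1 bounds all lengths *)
(* from below; a path along which the bound is attained is a geodesic.        *)
Lemma hyp_distE p q (d : R) :
  (forall x y, C1_path_in_H2 x y p q -> d <= hyp_length x y) ->
  (exists x y, C1_path_in_H2 x y p q /\ hyp_length x y = d) ->
  hyp_dist p q = d.
Proof.
move=> lb [x [y [xyP xyd]]].
have dP : [set l | exists x y, C1_path_in_H2 x y p q /\ l = hyp_length x y] d.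
  by exists x, y.
apply/eqP; rewrite eq_le; apply/andP; split.
  by apply: ge_inf => //; exists d => l [x' [y' [P ->]]]; exact: lb.
by apply: lb_le_inf; [exists d|move=> l [x' [y' [P ->]]]; exact: lb].
Qed.

End Length.

(** * Closed formula for the distance *)

Section Distance.
Context {R : realType}.
Implicit Types (p q : R * R) (x y : R -> R).

(** This is [2 cosh d(p, q)]; the factor 2 makes it [expR d + expR (- d)], see [cosh_hyp_dist]. *)
Definition cosh2 p q : R :=
  ((p.1 - q.1) ^+ 2 + p.2 ^+ 2 + q.2 ^+ 2) / (p.2 * q.2).

Lemma expR_norm_sum (l : R) : expR `|l| + expR (- `|l|) = expR l + expR (- l).
Proof. by case: (ger0P l) => _ //; rewrite opprK addrC. Qed.

Lemma is_derive_expR_affine (s l t : R) :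
  is_derive t 1 (fun u => expR (s + l * u)) (l * expR (s + l * t)).
Proof.
have h : is_derive t 1 (fun u => s + l * u) l.
  by apply: is_derive_eq; rewrite ?scaler0 ?addr0 ?add0r ?mul1r /GRing.scale/= ?mulr1 ?mul1r.
have := @is_derive1_comp _ expR _ t _ _ (is_derive_expR _) h.
by rewrite mulrC.
Qed.

Lemma C1_of_is_derive x (dx : R -> R) :
  (forall t : R, is_derive t 1 x (dx t)) -> (forall t, derivable dx t 1) ->
  (forall t : R, derivable x t 1) /\ continuous (derive1 x).
Proof.
move=> xd d2; split=> [t|]; first by have [] := xd t.
rewrite (_ : derive1 x = dx); first by move=> t; exact: derivable_continuous_at.
by apply/funext => t; rewrite derive1E; have [] := xd t.
Qed.

(** The potential is [ln y], whose derivative along a curve is at most the speed; the vertical path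
    of exponential height attains the bound. *)
Lemma vertical_distance p q : H2 p -> H2 q -> p.1 = q.1 ->
  hyp_dist p q = `|ln (q.2 / p.2)|.
Proof.
rewrite /H2/= => p0 q0 pq1; set l := ln _.
have lE : l = ln q.2 - ln p.2 by rewrite /l lnM ?lnV ?posrE ?invr_gt0.
apply: hyp_distE => [x y xyP|].
  have [[dx cx] [dy cy] yp xy0 xy1] := xyP.
  have dP (t : R) : 0 <= t <= 1 ->
      is_derive t 1 (fun u : R => ln (y u)) ((y t)^-1 * derive1 y t).
    move=> /yp yt.
    have := @is_derive1_ln _ _ yt.
    have : is_derive t 1 y (derive1 y t).
      by rewrite derive1E; apply: DeriveDef => //; exact: dy.
    by move=> ? ?; exact: is_derive1_comp.
  have y0E : y 0 = p.2 by rewrite -xy0.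
  have y1E : y 1 = q.2 by rewrite -xy1.
  rewrite lE -y0E -y1E; apply: (le_hyp_length xyP dP).
    apply: continuous_in_subspaceT => t; rewrite inE/= in_itv/= => /yp yt.
    apply: cvgM; last exact: cy.
    apply: cvgV; first by rewrite gt_eqF.
    exact/derivable_continuous_at/dy.
  move=> t /yp/=; rewrite /H2/= => yt; rewrite normrM normfV (gtr0_norm yt).
  rewrite mulrC /speed ler_pM2r ?invr_gt0// -sqrtr_sqr ler_wsqrtr//.
  by rewrite lerDr sqr_ge0.
have expl : expR l = q.2 / p.2 by rewrite /l lnK// posrE divr_gt0.
have dy (t : R) : is_derive t 1 (fun u => p.2 * expR (0 + l * u))
    (p.2 * (l * expR (0 + l * t))).
  exact: (is_deriveZ p.2 (is_derive_expR_affine 0 l t)).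
have d1y t : derive1 (fun u => p.2 * expR (0 + l * u)) t =
    p.2 * (l * expR (0 + l * t)).
  by rewrite derive1E; have [] := dy t.
exists (fun=> p.1), (fun t => p.2 * expR (0 + l * t)); split; last first.
  apply: hyp_length_const_speed => t.
  rewrite /speed d1y derive1_cst expr0n/= add0r sqrtr_sqr.
  rewrite normrM normrM (gtr0_norm p0) (gtr0_norm (expR_gt0 _)).
  have := expR_gt0 (0 + l * t) => e0; field; lra.
split => //.
- by apply: (C1_of_is_derive (dx := cst 0)) => t; exact: derivable_cst.
- apply: (C1_of_is_derive dy) => t.
  by case: (is_deriveZ p.2 (is_deriveZ l (is_derive_expR_affine 0 l t))).
- by move=> t _; rewrite /H2/= mulr_gt0// expR_gt0.
- by rewrite mulr0 addr0 expR0 mulr1 -surjective_pairing.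
- rewrite mulr1 add0r expl mulrC divfK ?gt_eqF//.
  by rewrite pq1 -surjective_pairing.
Qed.

(* Cauchy-Schwarz: ln |z - c + r| - ln |z - c - r| has hyperbolic gradient    *)
(* norm at most 1 (with X = x - c and tangent vector (u, v)).                 *)
Lemma potential_gradient (X r y u v : R) : 0 < y -> r != 0 ->
  `|((X + r) * u + y * v) / ((X + r) ^+ 2 + y ^+ 2) -
    ((X - r) * u + y * v) / ((X - r) ^+ 2 + y ^+ 2)|
  <= Num.sqrt (u ^+ 2 + v ^+ 2) / y.
Proof.
move=> y0 r0; set A := (X + r) ^+ 2 + _; set B := (X - r) ^+ 2 + _.
have A0 : 0 < A by rewrite ltr_wpDl ?sqr_ge0 ?exprn_gt0.
have B0 : 0 < B by rewrite ltr_wpDl ?sqr_ge0 ?exprn_gt0.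
rewrite ler_pdivlMr// -[X in _ * X <= _](gtr0_norm y0) -normrM -sqrtr_sqr ler_wsqrtr//.
have -> : (((X + r) * u + y * v) / A - ((X - r) * u + y * v) / B) * y =
  2 * r * y * ((y ^+ 2 + r ^+ 2 - X ^+ 2) * u - 2 * X * y * v) / (A * B).
  by rewrite /A /B; field; rewrite -/A -/B !gt_eqF.
set N := (_ * u - _).
have N2 : N ^+ 2 <= (A * B) * (u ^+ 2 + v ^+ 2).
  rewrite -subr_ge0.
  have -> : (A * B) * (u ^+ 2 + v ^+ 2) - N ^+ 2 =
    ((y ^+ 2 + r ^+ 2 - X ^+ 2) * v + 2 * X * y * u) ^+ 2.
    by rewrite /A /B /N; ring.
  exact: sqr_ge0.
have ry : (2 * r * y) ^+ 2 <= A * B.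
  rewrite -subr_ge0.
  have -> : A * B - (2 * r * y) ^+ 2 = (X ^+ 2 + y ^+ 2 - r ^+ 2) ^+ 2.
    by rewrite /A /B; ring.
  exact: sqr_ge0.
have AB0 : 0 < A * B by rewrite mulr_gt0.
rewrite expr_div_n ler_pdivrMr ?exprn_gt0// exprMn.
apply: le_trans (ler_pM (sqr_ge0 _) (sqr_ge0 _) ry N2) _.
by rewrite mulrA -expr2 mulrC.
Qed.

(** Logarithm of the ratio of the Euclidean distances from [p] to the ideal points [c - r] and
    [c + r]; on the semicircle joining them it is the signed arc length from the top. *)
Definition potential (c r : R) p : R :=
  (ln ((p.1 - c + r) ^+ 2 + p.2 ^+ 2) - ln ((p.1 - c - r) ^+ 2 + p.2 ^+ 2)) / 2.

Lemma potential_circle (c r : R) p : 0 < r -> H2 p ->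
  (p.1 - c) ^+ 2 + p.2 ^+ 2 = r ^+ 2 ->
  0 < r - (p.1 - c) /\ expR (potential c r p) = p.2 / (r - (p.1 - c)).
Proof.
rewrite /H2/= => r0 p0; rewrite /potential; set X := p.1 - c => Xr.
have rX : 0 < r - X by nra.
have rX' : 0 < r + X by nra.
split=> //.
have -> : (X + r) ^+ 2 + p.2 ^+ 2 = 2 * r * (r + X) by nra.
have -> : (X - r) ^+ 2 + p.2 ^+ 2 = 2 * r * (r - X) by nra.
rewrite -ln_div ?posrE ?mulr_gt0//.
have -> : 2 * r * (r + X) / (2 * r * (r - X)) = (p.2 / (r - X)) ^+ 2.
  rewrite expr_div_n; have -> : p.2 ^+ 2 = (r - X) * (r + X) by nra.
  by field; lra.
rewrite lnXn ?divr_gt0//.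
by rewrite -[ln _ *+ 2]mulr_natr mulfK// lnK// posrE divr_gt0.
Qed.

(** Inverse of [potential_circle]: with [e = expR a] the two expressions are [c + r tanh a] and
    [r / cosh a], the parametrization used in [semicircle_path]. *)
Lemma circle_parameter (c r : R) p : 0 < r -> 0 < r - (p.1 - c) ->
  (p.1 - c) ^+ 2 + p.2 ^+ 2 = r ^+ 2 -> let e := p.2 / (r - (p.1 - c)) in
  c + r - 2 * r / (e ^+ 2 + 1) = p.1 /\ 2 * r * e / (e ^+ 2 + 1) = p.2.
Proof.
move=> r0 rX pr /=; set X := p.1 - c in rX pr *.
have -> : (p.2 / (r - X)) ^+ 2 = (r + X) / (r - X).
  rewrite expr_div_n; have -> : p.2 ^+ 2 = (r + X) * (r - X) by nra.
  by field; lra.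
have -> : p.1 = c + X by rewrite /X; ring.
by split; field; lra.
Qed.

Lemma potential_le_length (c r : R) x y p q : r != 0 -> C1_path_in_H2 x y p q ->
  `|potential c r q - potential c r p| <= hyp_length x y.
Proof.
move=> r0 xyP; have [[dx cx] [dy cy] yp <- <-] := xyP.
have xd (t : R) : is_derive t 1 x (derive1 x t).
  by rewrite derive1E; apply: DeriveDef => //; exact: dx.
have yd (t : R) : is_derive t 1 y (derive1 y t).
  by rewrite derive1E; apply: DeriveDef => //; exact: dy.
pose Q (a : R) (u : R) := (x u - c + a) ^+ 2 + y u ^+ 2.
have Q0 (a t : R) : 0 <= t <= 1 -> 0 < Q a t.
  by move=> /yp yt; rewrite ltr_wpDl ?sqr_ge0 ?exprn_gt0.
have xa (a t : R) : is_derive t 1 (fun u : R => x u - c + a) (derive1 x t).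
  have := is_deriveD (is_deriveB (xd t) (is_derive_cst c t 1))
    (is_derive_cst a t 1).
  by rewrite subr0 addr0.
have sq (f : R -> R) d (t : R) : is_derive t 1 f d ->
    is_derive t 1 (fun u => f u ^+ 2) (2 * (f t * d)).
  move=> fd; have := is_deriveM fd fd.
  rewrite /GRing.scale/= -mulr2n mulr_natl.
  by rewrite (_ : f * f = fun u => f u ^+ 2)//; apply/funext => u; rewrite expr2.
have Qd (a t : R) : is_derive t 1 (Q a)
    (2 * ((x t - c + a) * derive1 x t + y t * derive1 y t)).
  by rewrite mulrDr; exact: (is_deriveD (sq _ _ _ (xa a t)) (sq _ _ _ (yd t))).
have lnQ (a t : R) : 0 <= t <= 1 -> is_derive t 1 (fun u : R => ln (Q a u))
    ((Q a t)^-1 *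
     (2 * ((x t - c + a) * derive1 x t + y t * derive1 y t))).
  move=> t01; have := @is_derive1_ln _ _ (Q0 a t t01) => h1.
  by have := Qd a t => h2; exact: is_derive1_comp.
pose D (t : R) := ((x t - c + r) * derive1 x t + y t * derive1 y t) / Q r t -
  ((x t - c - r) * derive1 x t + y t * derive1 y t) / Q (- r) t.
apply: (le_hyp_length (phi := fun t => potential c r (x t, y t)) (dphi := D)
  xyP).
- move=> t t01; have := is_deriveZ 2^-1 (is_deriveB (lnQ r t t01) (lnQ (- r) t t01)).
  rewrite (_ : _ *: _ = D t); last first.
    rewrite /D /GRing.scale/=; field.
    by rewrite !gt_eqF ?Q0.
  rewrite (_ : _ \*: _ = (fun u => potential c r (x u, y u)))//.
  by apply/funext => u; rewrite /potential/= [RHS]mulrC.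
- apply: continuous_in_subspaceT => t; rewrite inE/= in_itv/= => t01.
  have cQ (a : R) : Q a @ t --> Q a t.
    by apply: derivable_continuous_at; case: (Qd a t).
  have cN (a : R) : (fun u => (x u - c + a) * derive1 x u + y u * derive1 y u) @ t -->
      (x t - c + a) * derive1 x t + y t * derive1 y t.
    apply: cvgD; apply: cvgM; [|exact: cx| |exact: cy].
      by apply: derivable_continuous_at; case: (xa a t).
    by apply: derivable_continuous_at; exact: dy.
  by apply: cvgB; apply: cvgM; [exact: cN|apply: cvgV;[by rewrite gt_eqF ?Q0|exact: cQ]
    |exact: cN|apply: cvgV;[by rewrite gt_eqF ?Q0|exact: cQ]].
- by move=> t /yp yt; exact: potential_gradient.
Qed.

(* The path is (c + r tanh a, r / cosh a) with a = s + l t.                   *)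
Lemma semicircle_path (c r s l : R) : 0 < r ->
  exists x y : R -> R,
    [/\ forall t, x t = c + r - 2 * r / (expR (s + l * t) ^+ 2 + 1),
        forall t, y t = 2 * r * expR (s + l * t) / (expR (s + l * t) ^+ 2 + 1),
        forall p q, (x 0, y 0) = p -> (x 1, y 1) = q -> C1_path_in_H2 x y p q &
        hyp_length x y = `|l|].
Proof.
move=> r0; pose e (t : R) := expR (s + l * t).
have e0 (t : R) : 0 < e t by exact: expR_gt0.
pose g (t : R) := (e t ^+ 2 + 1)^-1.
have g0 (t : R) : 0 < g t by rewrite invr_gt0 ltr_wpDl ?sqr_ge0.
have ed (t : R) : is_derive t 1 e (l * e t) by exact: is_derive_expR_affine.
have gd (t : R) : is_derive t 1 g (- (2 * l * e t ^+ 2 * g t ^+ 2)).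
  have d1 : is_derive t 1 (fun u : R => e u ^+ 2 + 1) (2 * l * e t ^+ 2).
    have := is_deriveD (is_deriveM (ed t) (ed t)) (is_derive_cst (1 : R) t 1).
    rewrite addr0 /GRing.scale/= (_ : _ + _ = 2 * l * e t ^+ 2); last by ring.
    rewrite (_ : e * e + cst 1 = fun u : R => e u ^+ 2 + 1)//.
  have := is_deriveV _ d1; rewrite gt_eqF ?ltr_wpDl ?sqr_ge0// => /(_ isT).
  rewrite (_ : _ *: _ = - (2 * l * e t ^+ 2 * g t ^+ 2))//.
  by rewrite /g /GRing.scale/= exprVn; ring.
pose x (t : R) := c + r - 2 * r * g t.
pose y (t : R) := 2 * r * e t * g t.
pose dx (t : R) := 2 * r * (2 * l * e t ^+ 2 * g t ^+ 2).
pose dy (t : R) := 2 * r * (l * e t * g t - 2 * l * e t ^+ 3 * g t ^+ 2).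
have xd (t : R) : is_derive t 1 x (dx t).
  have := is_deriveB (is_derive_cst (c + r) t 1) (is_deriveZ (2 * r) (gd t)).
  by rewrite (_ : _ - _ = dx t)// /dx /GRing.scale/=; ring.
have yd (t : R) : is_derive t 1 y (dy t).
  have := is_deriveZ (2 * r) (is_deriveM (ed t) (gd t)).
  rewrite (_ : _ *: _ = dy t); last by rewrite /dy /GRing.scale/=; ring.
  rewrite (_ : _ \*: _ = y)//.
  by apply/funext => u; rewrite /y -[RHS]mulrA.
have de (t : R) : derivable e t 1 by case: (ed t).
have dg (t : R) : derivable g t 1 by case: (gd t).
have dgg (t : R) : derivable (g * g) t 1 by exact: derivableM.
have dee (t : R) : derivable (e * e) t 1 by exact: derivableM.
exists x, y; split; [by []|by []| |].
  move=> p q p0 q0; split; [| | |exact: p0|exact: q0].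
  - apply: (C1_of_is_derive xd) => t.
    rewrite (_ : dx = (2 * r * (2 * l)) \*: ((e * e) * (g * g))).
      by apply: derivableZ; exact: derivableM.
    apply/funext => u.
    transitivity (2 * r * (2 * l) * (e u * e u * (g u * g u))) => [|//].
    by rewrite /dx; ring.
  - apply: (C1_of_is_derive yd) => t.
    rewrite (_ : dy = (2 * r * l) \*: (e * g - 2 \*: ((e * e) * (e * (g * g))))).
      apply: derivableZ; apply: derivableB; first exact: derivableM.
      by apply: derivableZ; apply: derivableM => //; exact: derivableM.
    apply/funext => u.
    transitivity (2 * r * l * (e u * g u - 2 * (e u * e u * (e u * (g u * g u)))))
      => [|//].
    by rewrite /dy; ring.
  - by move=> t _; rewrite /H2/= /y !mulr_gt0.
apply: hyp_length_const_speed => t.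
rewrite /speed !derive1E; have [_ ->] := xd t; have [_ ->] := yd t.
have yt : 0 < y t by rewrite /y !mulr_gt0.
rewrite (_ : _ + _ = (l * y t) ^+ 2).
  by rewrite sqrtr_sqr normrM (gtr0_norm yt) mulfK ?gt_eqF.
rewrite /dx /dy /y /g; field.
by rewrite gt_eqF// ltr_wpDl ?sqr_ge0.
Qed.

Lemma semicircle_distance p q : H2 p -> H2 q -> p.1 != q.1 ->
  exists l, hyp_dist p q = `|l| /\ expR l + expR (- l) = cosh2 p q.
Proof.
move=> p0 q0 pq.
(* The point of the real axis equidistant, in the Euclidean sense, from [p] and [q]: the centre of
   the geodesic through them. *)
pose c := (q.1 ^+ 2 + q.2 ^+ 2 - p.1 ^+ 2 - p.2 ^+ 2) / (2 * (q.1 - p.1)).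
pose r := Num.sqrt ((p.1 - c) ^+ 2 + p.2 ^+ 2).
have qp : q.1 - p.1 != 0 by rewrite subr_eq0 eq_sym.
have r0 : 0 < r by rewrite sqrtr_gt0 ltr_wpDl ?sqr_ge0 ?exprn_gt0.
have pr : (p.1 - c) ^+ 2 + p.2 ^+ 2 = r ^+ 2.
  by rewrite sqr_sqrtr// addr_ge0 ?sqr_ge0.
have qr : (q.1 - c) ^+ 2 + q.2 ^+ 2 = r ^+ 2.
  by rewrite -pr /c; field.
have [rp ep] := potential_circle r0 p0 pr.
have [rq eq] := potential_circle r0 q0 qr.
set s := potential c r p in ep; set s' := potential c r q in eq.
exists (s' - s); split.
  apply: hyp_distE => [x y|]; first by apply: potential_le_length; rewrite gt_eqF.
  have [x [y [xE yE P len]]] := semicircle_path c s (s' - s) r0.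
  exists x, y; split=> //.
  have [p1 p2] := circle_parameter r0 rp pr.
  have [q1 q2] := circle_parameter r0 rq qr.
  apply: P; rewrite xE yE ?mulr0 ?addr0 ?mulr1 ?[s + _]addrC ?subrK ?ep ?eq.
    by rewrite p1 p2 -surjective_pairing.
  by rewrite q1 q2 -surjective_pairing.
move: p0 q0; rewrite /H2/= => p0 q0.
rewrite opprB !expRB ep eq /cosh2.
apply/(mulfI (x := p.2 * q.2 * ((r - (p.1 - c)) * (r - (q.1 - c))))).
  by rewrite gt_eqF// !mulr_gt0.
transitivity (q.2 ^+ 2 * (r - (p.1 - c)) ^+ 2 + p.2 ^+ 2 * (r - (q.1 - c)) ^+ 2).
  by field; rewrite !gt_eqF.
transitivity (((p.1 - q.1) ^+ 2 + p.2 ^+ 2 + q.2 ^+ 2) * ((r - (p.1 - c)) * (r - (q.1 - c)))); last by field; rewrite !gt_eqF.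
have -> : p.2 ^+ 2 = r ^+ 2 - (p.1 - c) ^+ 2 by rewrite -pr; ring.
have -> : q.2 ^+ 2 = r ^+ 2 - (q.1 - c) ^+ 2 by rewrite -qr; ring.
by ring.
Qed.

Lemma cosh_hyp_dist p q : H2 p -> H2 q ->
  expR (hyp_dist p q) + expR (- hyp_dist p q) = cosh2 p q.
Proof.
move=> p0 q0; have [pq|pq] := eqVneq p.1 q.1; last first.
  have [l [-> <-]] := semicircle_distance p0 q0 pq.
  exact: expR_norm_sum.
rewrite vertical_distance// expR_norm_sum.
move: p0 q0; rewrite /H2/= => p0 q0.
rewrite -lnV ?posrE ?divr_gt0// !lnK ?posrE ?invr_gt0 ?divr_gt0//.
by rewrite /cosh2 pq subrr; field; rewrite !gt_eqF.
Qed.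

(** Injectivity is left out because it follows from the last clause, see [cosh_isometry_inj]. *)
Definition cosh_isometry (f : R * R -> R * R) : Prop :=
  [/\ forall p, H2 p -> H2 (f p),
      forall q, H2 q -> exists2 p, H2 p & f p = q &
      forall p q, H2 p -> H2 q -> cosh2 (f p) (f q) = cosh2 p q].

Lemma hyp_isometry_cosh f : hyp_isometry f -> cosh_isometry f.
Proof.
move=> [[fH _ fsurj] df]; split=> // p q p0 q0.
by rewrite -!cosh_hyp_dist ?df//; exact: fH.
Qed.

End Distance.

(** * Isometries of the upper half-plane *)

Section CoshIsometries.
Context {R : realType}.
Implicit Types (p q : R * R) (f g h : R * R -> R * R).

Lemma cosh2C p q : cosh2 p q = cosh2 q p.
Proof. by rewrite /cosh2 -sqrrN opprB [p.2 * _]mulrC addrAC. Qed.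

Lemma cosh2_subr2 p q : H2 p -> H2 q ->
  cosh2 p q - 2 = ((p.1 - q.1) ^+ 2 + (p.2 - q.2) ^+ 2) / (p.2 * q.2).
Proof.
by rewrite /H2/= /cosh2 => p0 q0; field; rewrite !gt_eqF.
Qed.

Lemma cosh2xx p : H2 p -> cosh2 p p = 2.
Proof.
move=> p0; apply/eqP; rewrite -subr_eq0 cosh2_subr2// !subrr.
by rewrite expr0n/= addr0 mul0r.
Qed.

Lemma cosh2_eq2 p q : H2 p -> H2 q -> cosh2 p q = 2 -> p = q.
Proof.
move=> p0 q0 pq2; have := cosh2_subr2 p0 q0.
rewrite pq2 subrr => /esym/eqP; rewrite mulf_eq0 invr_eq0 mulf_eq0.
move: (p0) (q0); rewrite /H2/= => /gt_eqF -> /gt_eqF ->; rewrite !orbF.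
rewrite paddr_eq0 ?sqr_ge0// !sqrf_eq0 !subr_eq0 => /andP[/eqP e1 /eqP e2].
by rewrite [LHS]surjective_pairing e1 e2 -surjective_pairing.
Qed.

(* 2 cosh (a + b) <= (2 cosh a) (2 cosh b)                                    *)
Lemma cosh2_triangle p r q : H2 p -> H2 r -> H2 q ->
  cosh2 p q <= cosh2 p r * cosh2 r q.
Proof.
rewrite /H2/= => p0 r0 q0; rewrite /cosh2 mulf_div.
rewrite ler_pdivrMr ?mulr_gt0// mulrAC ler_pdivlMr ?mulr_gt0 ?mulr_gt0//.
rewrite -subr_ge0; set X := p.1 - r.1; set Y := r.1 - q.1.
have -> : p.1 - q.1 = X + Y by rewrite /X /Y; ring.
have -> : (X ^+ 2 + p.2 ^+ 2 + r.2 ^+ 2) * (Y ^+ 2 + r.2 ^+ 2 + q.2 ^+ 2) *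
    (p.2 * q.2) - ((X + Y) ^+ 2 + p.2 ^+ 2 + q.2 ^+ 2) *
    (p.2 * r.2 * (r.2 * q.2)) =
  ((X * Y - r.2 ^+ 2) ^+ 2 + (X * q.2) ^+ 2 + (Y * p.2) ^+ 2
   + (p.2 * q.2) ^+ 2) * (p.2 * q.2) by ring.
by rewrite mulr_ge0 ?addr_ge0 ?sqr_ge0// ltW// mulr_gt0.
Qed.

Lemma cosh_isometry_inj f p q : cosh_isometry f -> H2 p -> H2 q ->
  f p = f q -> p = q.
Proof.
move=> [fH _ fc] p0 q0 fpq; apply: cosh2_eq2 => //.
by rewrite -fc// fpq cosh2xx//; exact: fH.
Qed.

Lemma cosh_isometry_comp f g : cosh_isometry f -> cosh_isometry g ->
  cosh_isometry (f \o g).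
Proof.
move=> [fH fs fc] [gH gs gc]; split=> [p /gH/fH//|q /fs[p /gs[r r0 <-] <-]|p q p0 q0].
  by exists r.
by rewrite /= fc ?gc//; exact: gH.
Qed.

(** The preimage is sought in [H2] because [f] is arbitrary elsewhere; [q] is the default value when
    there is none. *)
Definition H2_inv f q : R * R := xget q [set p | H2 p /\ f p = q].

Lemma H2_invK f q : cosh_isometry f -> H2 q -> H2 (H2_inv f q) /\ f (H2_inv f q) = q.
Proof.
move=> [_ fs _] q0; rewrite /H2_inv; case: xgetP => [p _ []//|/= no].
by have [p p0 fp] := fs q q0; case: (no p).
Qed.

Lemma H2_invV f p : cosh_isometry f -> H2 p -> H2_inv f (f p) = p.
Proof.
move=> fi p0; have fp0 : H2 (f p) by case: fi => + _ _; exact.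
by have [i0 /(cosh_isometry_inj fi i0 p0)] := H2_invK fi fp0.
Qed.

Lemma cosh_isometry_inv f : cosh_isometry f -> cosh_isometry (H2_inv f).
Proof.
move=> fi; have [fH fs fc] := fi; split.
- by move=> q /(H2_invK fi)[].
- by move=> p p0; exists (f p); [exact: fH|exact: H2_invV].
- move=> p q p0 q0; have [p1 {2}<-] := H2_invK fi p0.
  by have [q1 {2}<-] := H2_invK fi q0; rewrite fc.
Qed.

(* The isometries fixing the ideal point at infinity are those multiplying    *)
(* heights by a constant.                                                     *)
Definition fixes_infty f : Prop :=
  exists2 k : R, 0 < k & forall p, H2 p -> (f p).2 = k * p.2.

(* In the hyperboloid model a point is the vector (1/y, x/y, (x^2+y^2)/y) and *)
(* the ideal point at infinity is the null vector (0, 0, 1), a combination of *)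
(* the vectors of (0, 1) and (0, 2); its image is a null vector again, which  *)
(* is the equation of a horocycle.                                            *)
Lemma horocycle_dichotomy h : cosh_isometry h -> fixes_infty h \/
  exists xi k : R, 0 < k /\
    forall p, H2 p -> p.2 * (((h p).1 - xi) ^+ 2 + (h p).2 ^+ 2) = k * (h p).2.
Proof.
move=> [hH _ hc].
have aH : H2 ((0, 1) : R * R) by rewrite /H2/= ltr01.
have bH : H2 ((0, 2) : R * R) by rewrite /H2/= ltr0n.
move: (hH _ aH) (hH _ bH) (hc _ _ aH bH) (fun p (p0 : H2 p) => hc p _ p0 aH)
  (fun p (p0 : H2 p) => hc p _ p0 bH).
case: (h (0, 1)) (h (0, 2)) => [a1 a2] [b1 b2].
rewrite {1 2}/H2 /cosh2/= => a0 b0 ab ha hb.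
(* The vector (0, 0, 1) is a third of twice the vector of (0, 2) minus that of (0, 1); [E1], [E2],
   [E3] are the same combination of the image vectors. [EE] says that it is null, and [key] that its
   pairing with [h p] is still the inverse height of [p]. *)
pose E1 := (2 / b2 - a2^-1) / 3.
pose E2 := (2 * b1 / b2 - a1 / a2) / 3.
pose E3 := (2 * (b1 ^+ 2 + b2 ^+ 2) / b2 - (a1 ^+ 2 + a2 ^+ 2) / a2) / 3.
have EE : E1 * E3 = E2 ^+ 2.
  apply/eqP; rewrite -subr_eq0; apply/eqP.
  transitivity ((5 - 2 * (((a1 - b1) ^+ 2 + a2 ^+ 2 + b2 ^+ 2) / (a2 * b2))) / 9).
    by rewrite /E1 /E2 /E3; field; rewrite !gt_eqF.
  by rewrite ab; field.
have key p : H2 p ->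
    (h p).2 = p.2 * (E1 * ((h p).1 ^+ 2 + (h p).2 ^+ 2) - 2 * E2 * (h p).1 + E3).
  move=> p0; have := hH p p0; have := ha p p0; have := hb p p0; move: p0.
  case: (h p) => x y; rewrite /H2/= => p0 hb' ha' y0.
  have -> : E1 * (x ^+ 2 + y ^+ 2) - 2 * E2 * x + E3 =
    y * (2 * (((x - b1) ^+ 2 + y ^+ 2 + b2 ^+ 2) / (y * b2)) -
      ((x - a1) ^+ 2 + y ^+ 2 + a2 ^+ 2) / (y * a2)) / 3.
    by rewrite /E1 /E2 /E3; field; rewrite !gt_eqF.
  by rewrite hb' ha'; field; rewrite gt_eqF.
have [E10|E10] := eqVneq E1 0.
  left; have E20 : E2 = 0.
    by apply/eqP; rewrite -sqrf_eq0 -EE E10 mul0r.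
  have kE p : H2 p -> (h p).2 = E3 * p.2.
    by move=> /key ->; rewrite E10 E20; ring.
  exists E3 => //.
  by have := hH _ aH; rewrite /H2/= kE//= mulr1.
have E1p : 0 < E1.
  have := key _ aH; have := hH _ aH; rewrite /H2/=.
  case: (h (0, 1)) => x y /= y0; rewrite mul1r => yE.
  rewrite lt_neqAle eq_sym E10/= leNgt; apply/negP => E1n.
  have : E1 * y = (E1 * x - E2) ^+ 2 + E1 ^+ 2 * y ^+ 2.
    rewrite {1}yE mulrDr EE; ring.
  have : E1 * y < 0 by rewrite nmulr_rlt0.
  move=> + e; rewrite e ltNge addr_ge0 ?sqr_ge0//.
  by apply: mulr_ge0; exact: sqr_ge0.
right; exists (E2 / E1), E1^-1; split; first by rewrite invr_gt0.
move=> p p0; rewrite [in RHS](key p p0); have -> : E3 = E2 ^+ 2 / E1.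
  by rewrite -EE mulrAC divff ?mul1r.
by field.
Qed.

(** A negative [s] gives the orientation-reversing isometries fixing infinity. *)
Definition similarity (s t : R) p : R * R := (s * p.1 + t, `|s| * p.2).

(** Once heights scale by [k], preservation of [cosh2] makes horizontal differences scale by [k] up
    to sign. Comparing with both (0, 1) and (1, 1) removes the sign ambiguity: the difference of the
    two squared relations is linear. *)
Lemma fixes_infty_similarity h : cosh_isometry h -> fixes_infty h ->
  exists s t, s != 0 /\ forall p, H2 p -> h p = similarity s t p.
Proof.
move=> [hH _ hc] [k k0 hk].
have dx p q : H2 p -> H2 q -> ((h p).1 - (h q).1) ^+ 2 = k ^+ 2 * (p.1 - q.1) ^+ 2.
  move=> p0 q0; have := hc _ _ p0 q0; rewrite /cosh2 !hk//.
  move: p0 q0; rewrite /H2/= => p0 q0 /(congr1 (fun z => z * (k ^+ 2 * p.2 * q.2))).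
  have -> : forall z, z / (k * p.2 * (k * q.2)) * (k ^+ 2 * p.2 * q.2) = z.
    by move=> z; field; rewrite !gt_eqF.
  have -> : forall z, z / (p.2 * q.2) * (k ^+ 2 * p.2 * q.2) = k ^+ 2 * z.
    by move=> z; field; rewrite !gt_eqF.
  by move=> e; apply/eqP; rewrite -subr_eq0; apply/eqP; lra.
have aH : H2 ((0, 1) : R * R) by rewrite /H2/= ltr01.
have bH : H2 ((1, 1) : R * R) by rewrite /H2/= ltr01.
pose t := (h (0, 1)).1; pose s := (h (1, 1)).1 - t.
have s2 : s ^+ 2 = k ^+ 2 by rewrite /s /t dx//= subr0 expr1n mulr1.
have s0 : s != 0 by rewrite -sqrf_eq0 s2 sqrf_eq0 gt_eqF.
have sk : `|s| = k by rewrite -[LHS]sqrtr_sqr s2 sqrtr_sqr gtr0_norm.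
exists s, t; split=> // p p0; rewrite [LHS]surjective_pairing hk// /similarity sk.
congr pair; have := dx _ _ p0 aH; have := dx _ _ p0 bH; rewrite /= -/t subr0.
have -> : (h (1, 1)).1 = s + t by rewrite /s subrK.
rewrite -s2 => e1 e2; apply: (mulfI s0).
by apply/eqP; rewrite -subr_eq0; apply/eqP; nra.
Qed.

Lemma similarity_cosh_isometry s t : s != 0 -> cosh_isometry (similarity s t).
Proof.
move=> s0; have ns : 0 < `|s| by rewrite normr_gt0.
split=> [p|q|p q]; rewrite /H2/= /similarity.
- by move=> p0; rewrite mulr_gt0.
- move=> q0; exists ((q.1 - t) / s, q.2 / `|s|); first by rewrite /H2/= divr_gt0.
  by rewrite /= mulrC divfK// subrK mulrC divfK ?gt_eqF// -surjective_pairing.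
- move=> p0 q0; rewrite /cosh2/= !exprMn.
  have -> : s * p.1 + t - (s * q.1 + t) = s * (p.1 - q.1) by ring.
  rewrite exprMn -(real_normK (num_real s)); field.
  by rewrite !gt_eqF.
Qed.

End CoshIsometries.

(** * Packing and topology *)

Section Topology.
Context {R : realType}.
Implicit Types (p q : R * R) (f : R * R -> R * R) (A U : set (R * R)).

Lemma cosh2_ball_sub p U : H2 p -> nbhs p U ->
  exists2 e : R, 0 < e & forall q, H2 q -> cosh2 p q < 2 + e -> U q.
Proof.
rewrite /H2/= => p0 /nbhs_ballP[d /= d0 dU].
(* The bound 1/2 forces [q.2 <= 4 * p.2]; the other one then makes the squared Euclidean distance
   less than [d ^+ 2]. *)
pose e := Num.min 2^-1 (d ^+ 2 / (4 * p.2 ^+ 2)).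
have e0 : 0 < e by rewrite lt_min invr_gt0 ltr0n/= divr_gt0 ?mulr_gt0 ?exprn_gt0.
exists e => // q q0; rewrite -ltrBlDl cosh2_subr2// ltr_pdivrMr ?mulr_gt0// => pq.
have e2 : e <= 2^-1 by rewrite ge_min lexx.
have ed : e * (4 * p.2 ^+ 2) <= d ^+ 2.
  by rewrite -ler_pdivlMr ?mulr_gt0 ?exprn_gt0// ge_min lexx orbT.
have pq0 : 0 < p.2 * q.2 by rewrite mulr_gt0.
have q4 : q.2 <= 4 * p.2.
  rewrite leNgt; apply/negP => q4.
  have : (p.2 - q.2) ^+ 2 < 2^-1 * (p.2 * q.2).
    apply: (@lt_le_trans _ _ (e * (p.2 * q.2))); last by rewrite ler_pM2r.
    by apply: le_lt_trans pq; rewrite lerDr sqr_ge0.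
  by nra.
have pqd : (p.1 - q.1) ^+ 2 + (p.2 - q.2) ^+ 2 < d ^+ 2.
  apply: lt_le_trans pq _; apply: le_trans ed.
  rewrite ler_pM2l// expr2 mulrCA ler_pM2l//.
apply: dU; split; rewrite /ball/= -(@ltr_pXn2r _ 2)// ?nnegrE ?ltW// real_normK ?num_real//.
  by apply: le_lt_trans pqd; rewrite lerDl sqr_ge0.
by apply: le_lt_trans pqd; rewrite lerDr sqr_ge0.
Qed.

Lemma nbhs_cosh2_ball p (e : R) : H2 p -> 0 < e ->
  nbhs p [set q | H2 q /\ cosh2 p q < 2 + e].
Proof.
rewrite /H2/= => p0 e0; pose m := Num.min 1 e.
have m0 : 0 < m by rewrite lt_min ltr01.
have m1 : m <= 1 by rewrite ge_min lexx.
have me : m <= e by rewrite ge_min lexx orbT.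
apply/nbhs_ballP; exists (p.2 * m / 4); first by rewrite /= !mulr_gt0.
move=> q []; rewrite /ball/= => /ltr_normlP[a1 a2] /ltr_normlP[b1 b2].
have q0 : p.2 / 2 < q.2 by nra.
have q0' : 0 < q.2 by lra.
split=> //; rewrite -ltrBlDl cosh2_subr2// ltr_pdivrMr ?mulr_gt0//.
have d1 : (p.1 - q.1) ^+ 2 < (p.2 * m / 4) ^+ 2 by nra.
have d2 : (p.2 - q.2) ^+ 2 < (p.2 * m / 4) ^+ 2 by nra.
have : e * (p.2 * q.2) > m * (p.2 * (p.2 / 2)).
  apply: (@lt_le_trans _ _ (m * (p.2 * q.2))).
    by rewrite !ltr_pM2l.
  by rewrite ler_pM2r// mulr_gt0.
have : m * (p.2 * (p.2 / 2)) >= (p.2 * m) ^+ 2 / 2.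
  have -> : m * (p.2 * (p.2 / 2)) = (p.2 ^+ 2 * m / 2) * 1 by field.
  have -> : (p.2 * m) ^+ 2 / 2 = (p.2 ^+ 2 * m / 2) * m by field.
  by rewrite ler_pM2l// !mulr_gt0// exprn_gt0.
have : 0 <= (p.2 * m) ^+ 2 by exact: sqr_ge0.
have dE : (p.2 * m / 4) ^+ 2 = (p.2 * m) ^+ 2 / 16 by field.
rewrite dE in d1 d2.
by lra.
Qed.

Lemma cosh_isometry_interior f A p : cosh_isometry f -> H2 p ->
  A° p -> (f @` A)° (f p).
Proof.
move=> [fH fs fc] p0 /(cosh2_ball_sub p0)[e e0 eA].
apply: filterS (nbhs_cosh2_ball (fH _ p0) e0) => _ [/fs[q q0 <-]].
by rewrite fc// => /(eA _ q0) Aq; exists q.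
Qed.

Lemma cosh_isometry_nbhs f U p : cosh_isometry f -> H2 p ->
  nbhs (f p) U -> nbhs p (f @^-1` U).
Proof.
move=> [fH fs fc] p0 /(cosh2_ball_sub (fH _ p0))[e e0 eU].
apply: filterS (nbhs_cosh2_ball p0 e0) => q [q0 pq].
by apply: eU; [exact: fH|rewrite fc].
Qed.

Lemma finite_inj_sub (aT rT : Type) (A : set aT) (B : set rT) (f : aT -> rT) :
  {in A &, injective f} -> f @` A `<=` B -> finite_set B -> finite_set A.
Proof.
move=> fi AB Bf; rewrite -(eq_finite_set (inj_card_eq fi)).
exact: sub_finite_set Bf.
Qed.

Lemma truncn_eq_dist (a b : R) : 0 <= a -> 0 <= b -> Num.truncn a = Num.truncn b ->
  `|a - b| <= 1.
Proof.
move=> /truncn_itv/andP[a1 a2] /truncn_itv/andP[b1 b2] e.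
move: a1 a2; rewrite e => a1 a2.
have e1 : (Num.truncn b).+1%:R = (Num.truncn b)%:R + 1 :> R by rewrite -natr1.
by rewrite ler_norml; apply/andP; split; lra.
Qed.

Lemma norm_le_of_sqr (a b : R) : 0 <= b -> a ^+ 2 <= b ^+ 2 -> `|a| <= b.
Proof.
by move=> b0; rewrite -[leLHS]real_normK ?num_real// ler_pXn2r// nnegrE.
Qed.

(** Each bound keeps one square of the numerator of [cosh2]. They confine a hyperbolic ball to a
    Euclidean box away from the real axis. *)
Lemma cosh2_le_bounds z q (K : R) : H2 z -> H2 q -> cosh2 z q <= K ->
  [/\ 0 < K, q.2 <= K * z.2, z.2 <= K * q.2 & `|z.1 - q.1| <= K * z.2].
Proof.
rewrite /H2/= => z0 q0; rewrite ler_pdivrMr ?mulr_gt0// => zq.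
have zq0 : 0 < z.2 * q.2 by rewrite mulr_gt0.
have s0 := sqr_ge0 (z.1 - q.1).
have K0 : 0 < K.
  rewrite -(pmulr_lgt0 _ zq0); apply: lt_le_trans zq.
  by rewrite ltr_wpDl ?exprn_gt0// addr_ge0 ?sqr_ge0.
have q2 : q.2 <= K * z.2.
  rewrite -(ler_pM2r q0) -mulrA -expr2; apply: le_trans zq.
  by rewrite lerDr addr_ge0 ?sqr_ge0.
split=> //.
  rewrite -(ler_pM2l z0) mulrCA -expr2; apply: le_trans zq.
  by rewrite addrAC lerDr addr_ge0 ?sqr_ge0.
apply: norm_le_of_sqr; first by rewrite mulr_ge0// ltW.
apply: (@le_trans _ _ (K * (z.2 * q.2))).
  by apply: le_trans zq; rewrite -addrA lerDl addr_ge0 ?sqr_ge0.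
by rewrite exprMn expr2 -mulrA ler_pM2l// expr2 mulrCA ler_pM2l.
Qed.

(* A grid of mesh much smaller than the separation has at most one point of   *)
(* the family per cell.                                                       *)
Lemma finite_cosh2_separated (T : Type) (S : set T) (m : T -> R * R) z (K e : R) :
  H2 z -> 0 < e ->
  (forall t, S t -> H2 (m t) /\ cosh2 z (m t) <= K) ->
  (forall t t', S t -> S t' -> cosh2 (m t) (m t') < 2 + e -> t = t') ->
  finite_set S.
Proof.
move=> z0 e0 mK sep; have [->|/set0P[t0 St0]] := eqVneq S set0.
  exact: finite_set0.
have K0 : 0 < K.
  by have [m0 /(cosh2_le_bounds z0 m0)[]] := mK _ St0.
have z20 : 0 < z.2 by [].
(* All heights are at least [z.2 / K], so two points differing by at most [eta] in both coordinates
   have [cosh2 - 2] at most [u ^+ 2 / 2], which is less than [e]. *)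
pose u := Num.min 1 e; pose eta := z.2 / K * u / 2.
have u0 : 0 < u by rewrite lt_min ltr01.
have u1 : u <= 1 by rewrite ge_min lexx.
have ue : u <= e by rewrite ge_min lexx orbT.
have eta0 : 0 < eta by rewrite !mulr_gt0// invr_gt0.
(* The shift by [K * z.2] makes the first grid coordinate non-negative, so that truncation gives the
   cell. *)
pose X t := (K * z.2 + ((m t).1 - z.1)) / eta; pose Y t := (m t).2 / eta.
have XY t : S t -> [/\ 0 <= X t, 0 <= Y t, X t < 2 * (K * z.2) / eta + 1 &
    Y t < 2 * (K * z.2) / eta + 1].
  move=> St; have [m0 mKt] := mK _ St.
  have [_ b1 b2 /ler_normlP[b3 b4]] := cosh2_le_bounds z0 m0 mKt.
  have Kz : 0 < K * z.2 by rewrite mulr_gt0.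
  split; rewrite /X /Y.
  - by rewrite divr_ge0 ?(ltW eta0)//; lra.
  - by rewrite divr_ge0 ?ltW.
  - apply: (@le_lt_trans _ _ (2 * (K * z.2) / eta)); last by rewrite ltrDl.
    by rewrite ler_pM2r ?invr_gt0//; lra.
  - apply: (@le_lt_trans _ _ (2 * (K * z.2) / eta)); last by rewrite ltrDl.
    by rewrite ler_pM2r ?invr_gt0//; lra.
pose N := (Num.truncn (2 * (K * z.2) / eta + 1)).+1.
have trN x : 0 <= x -> x < 2 * (K * z.2) / eta + 1 -> (Num.truncn x < N)%N.
  move=> x0 xN; rewrite truncn_lt_nat//; apply: lt_trans xN _.
  have : 0 <= 2 * (K * z.2) / eta + 1.
    by rewrite addr_ge0// divr_ge0 ?ltW// !mulr_gt0.
  by move=> /truncn_itv/andP[].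
apply: (@finite_inj_sub _ _ S (`I_N `*` `I_N)
  (fun t => (Num.truncn (X t), Num.truncn (Y t)))); last first.
- exact: finite_setX.
- move=> _ [t St <-]; have [X0 Y0 XN YN] := XY _ St.
  by split; exact: trN.
move=> t t'; rewrite !inE => St St' [/truncn_eq_dist tX /truncn_eq_dist tY].
have [X0 Y0 _ _] := XY _ St; have [X0' Y0' _ _] := XY _ St'.
have {tX} : `|X t - X t'| <= 1 by exact: tX.
have {tY} : `|Y t - Y t'| <= 1 by exact: tY.
rewrite /X /Y -!mulrBl !normrM normfV (gtr0_norm eta0) !ler_pdivrMr// !mul1r.
rewrite opprD addrACA subrr add0r opprB addrA subrK => dY dX.
have [m0 mKt] := mK _ St; have [m0' mKt'] := mK _ St'.
have [_ _ l1 _] := cosh2_le_bounds z0 m0 mKt.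
have [_ _ l2 _] := cosh2_le_bounds z0 m0' mKt'.
apply: sep => //; rewrite -ltrBlDl cosh2_subr2// ltr_pdivrMr ?mulr_gt0//.
have sq (a : R) : `|a| <= eta -> a ^+ 2 <= eta ^+ 2.
  by move=> ae; rewrite -(real_normK (num_real a)) ler_pXn2r// ?nnegrE// ltW.
have {}dX := sq _ dX; have {}dY := sq _ dY.
have zK : (z.2 / K) ^+ 2 <= (m t).2 * (m t').2.
  have zK1 : 0 <= z.2 / K by rewrite divr_ge0 ?ltW.
  by rewrite expr2; apply: ler_pM => //; rewrite ler_pdivrMr// mulrC.
have zK0 : 0 < (z.2 / K) ^+ 2 by rewrite exprn_gt0// divr_gt0.
have e1 : e * (z.2 / K) ^+ 2 <= e * ((m t).2 * (m t').2) by rewrite ler_pM2l.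
have e2 : u * (z.2 / K) ^+ 2 <= e * (z.2 / K) ^+ 2 by rewrite ler_pM2r.
have e3 : eta ^+ 2 = (z.2 / K) ^+ 2 * u ^+ 2 / 4 by rewrite /eta; field; rewrite gt_eqF.
have e4 : (z.2 / K) ^+ 2 * u ^+ 2 <= (z.2 / K) ^+ 2 * u.
  by rewrite ler_pM2l// expr2 -[leRHS]mulr1 ler_pM2l.
have e5 : 0 < (z.2 / K) ^+ 2 * u by rewrite mulr_gt0.
by lra.
Qed.

End Topology.

(** * Pentagons sharing an edge *)

Section Pentagon.
Context {R : realType}.
Implicit Types (p q : R * R) (f g h : R * R -> R * R) (w : R) (e : set (R * R)).

Lemma uncountable_segment (a b : R) : a < b -> ~ countable (`[a, b]%classic : set R).
Proof.
move=> ab /countable_lebesgue_measure0; rewrite lebesgue_measure_itv/= lte_fin ab.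
by rewrite -EFinD => -[] /eqP; rewrite subr_eq0 gt_eqF.
Qed.

Lemma finite_sqr_eq (c m : R) : finite_set [set x : R | (x - c) ^+ 2 = m].
Proof.
apply: (@sub_finite_set _ _ [set c + Num.sqrt m; c - Num.sqrt m]).
  move=> x /= <-; rewrite sqrtr_sqr.
  by case: (ger0P (x - c)) => _; [left|right]; ring.
exact: finite_set2.
Qed.

Definition side_lines w : set (R * R) :=
  [set p | p.2 = 1 \/ p.2 = 2^-1 \/ p.1 = 0 \/ p.1 = w].

(** On each of the four lines one coordinate is fixed and the horocycle equation becomes quadratic
    in the other. *)
Lemma finite_circle_lines w (c xi k : R) : 0 < c ->
  finite_set (side_lines w `&`
    [set p | c * ((p.1 - xi) ^+ 2 + p.2 ^+ 2) = k * p.2]).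
Proof.
move=> c0; have c1 : c != 0 by rewrite gt_eqF.
have hor (v : R) : finite_set
    [set p : R * R | p.2 = v /\ c * ((p.1 - xi) ^+ 2 + p.2 ^+ 2) = k * p.2].
  apply: sub_finite_set (finite_image (fun x => (x, v))
    (finite_sqr_eq xi (k * v / c - v ^+ 2))).
  move=> [x y] /= [-> eq]; exists x => //=.
  by rewrite -eq mulrC mulKf// addrK.
have ver (v : R) : finite_set
    [set p : R * R | p.1 = v /\ c * ((p.1 - xi) ^+ 2 + p.2 ^+ 2) = k * p.2].
  apply: sub_finite_set (finite_image (fun y => (v, y))
    (finite_sqr_eq (k / c / 2) ((k / c / 2) ^+ 2 - (v - xi) ^+ 2))).
  move=> [x y] /= [-> eq]; exists y => //=.
  have {}eq : (v - xi) ^+ 2 + y ^+ 2 = k / c * y by rewrite mulrAC -eq mulrC mulKf.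
  by apply/eqP; rewrite -subr_eq0; apply/eqP; move: eq; set u := k / c; lra.
have := conj (conj (hor 1) (hor 2^-1)) (conj (ver 0) (ver w)).
rewrite -!finite_setU; apply: sub_finite_set => p [] /= [|[|[|]]] pE cp.
- by left; left.
- by left; right.
- by right; left.
- by right; right.
Qed.

(* A horocycle based at a finite point meets a line in at most two points.    *)
Lemma fixes_infty_of_lines w h (a b c : R) : cosh_isometry h -> a < b -> 0 < c ->
  (forall x, a <= x <= b -> side_lines w (h (x, c))) -> fixes_infty h.
Proof.
move=> hi ab c0 hl; have [//|[xi [k [k0 hk]]]] := horocycle_dichotomy hi.
exfalso; apply: (uncountable_segment ab); apply: finite_set_countable.
apply: (finite_inj_sub (f := fun x => h (x, c))) (finite_circle_lines w xi k c0).
  move=> x y _ _ /(cosh_isometry_inj hi) xy.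
  by have [] : (x, c) = (y, c) by apply: xy.
move=> q [x]; rewrite /= in_itv/= => xab <-; split; first exact: hl.
exact: (hk (x, c)).
Qed.

(** The frames [f] and [g] send infinity to the same ideal point, said without a boundary at
    infinity: the change of coordinates fixes infinity. *)
Definition same_infty f g : Prop := fixes_infty (H2_inv f \o g).

Lemma same_infty_sym f g : cosh_isometry f -> cosh_isometry g ->
  same_infty f g -> same_infty g f.
Proof.
move=> fi gi [k k0 fg]; exists k^-1; first by rewrite invr_gt0.
have [fH _ _] := fi.
move=> p p0; have [q0 gq] := H2_invK gi (fH _ p0).
by have := fg _ q0; rewrite /= gq H2_invV// => ->; rewrite mulKf// gt_eqF.
Qed.

Lemma same_infty_trans f g h : cosh_isometry f -> cosh_isometry g ->
  cosh_isometry h -> same_infty f g -> same_infty g h -> same_infty f h.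
Proof.
move=> fi gi hi [k k0 fg] [l l0 gh]; exists (k * l); first exact: mulr_gt0.
have [hH _ _] := hi.
move=> p p0; have [q0 gq] := H2_invK gi (hH _ p0).
by rewrite /= -{1}gq -mulrA -[l * _]gh//; exact: fg.
Qed.

Lemma pentagon_sub_H2 w p : pentagon w p -> H2 p.
Proof.
by move=> [_ /andP[p1 _]]; rewrite /H2/=; apply: lt_le_trans p1; rewrite invr_gt0.
Qed.

Lemma pentagon_interior w p : 0 < p.1 < w -> 2^-1 < p.2 < 1 -> (pentagon w)° p.
Proof.
move=> /andP[a1 a2] /andP[b1 b2].
apply/nbhs_ballP; exists (Num.min (Num.min p.1 (w - p.1))
  (Num.min (p.2 - 2^-1) (1 - p.2))).
  by rewrite /= !lt_min a1/= !subr_gt0 a2 b1 b2.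
move=> q [] /=; rewrite /ball/= !lt_min => /andP[/andP[c1 c2] _] /andP[_ /andP[d1 d2]].
move: c1 c2 d1 d2 => /ltr_normlP[c1 c1'] /ltr_normlP[c2 c2'].
move=> /ltr_normlP[d1 d1'] /ltr_normlP[d2 d2'].
by split; apply/andP; split; lra.
Qed.

Lemma pentagon_boundary w p : pentagon w p -> ~ (pentagon w)° p -> side_lines w p.
Proof.
move=> [/andP[a1 a2] /andP[b1 b2]] nI; rewrite /side_lines/=.
apply: contrapT => /not_orP[n1 /not_orP[n2 /not_orP[n3 n4]]]; apply: nI.
have lt (x y : R) : x <= y -> x <> y -> x < y.
  by move=> xy /eqP; rewrite lt_neqAle xy andbT.
apply: pentagon_interior; apply/andP; split; apply: lt => //; exact: nesym.
Qed.

Lemma pentagon_interior_lt1 w p : (pentagon w)° p -> p.2 < 1.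
Proof.
move=> /nbhs_ballP[d /= d0 dB].
have [_ /=/andP[_]] : pentagon w (p.1, p.2 + d / 2).
  apply: dB; split=> /=; rewrite /ball/= ?subrr ?normr0//.
  by rewrite opprD addNKr normrN gtr0_norm ?divr_gt0//; lra.
by lra.
Qed.

(** The change of coordinates maps the pentagon onto itself and is continuous both ways, so it sends
    the a-edge into the boundary, hence into [side_lines]. Thus the ideal point depends on the tile
    and not on its frame. *)
Lemma same_tile_same_infty w f g : 0 < w -> cosh_isometry f -> cosh_isometry g ->
  f @` pentagon w = g @` pentagon w -> same_infty f g.
Proof.
move=> w0 fi gi fg; have hi := cosh_isometry_comp (cosh_isometry_inv fi) gi.
set h := H2_inv f \o g in hi *.
have hB p : pentagon w p -> pentagon w (h p).
  move=> pB; have [q qB gp] : (f @` pentagon w) (g p) by rewrite fg; exists p.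
  by rewrite /h /= -gp H2_invV//; exact: pentagon_sub_H2 qB.
have hB' p : H2 p -> pentagon w (h p) -> pentagon w p.
  move=> p0 hpB; have [q qB gq] : (g @` pentagon w) (g p).
    by rewrite -fg; exists (h p) => //; case: (H2_invK fi (_ : H2 (g p))) => //; case: gi => + _ _; exact.
  by rewrite -(cosh_isometry_inj gi (pentagon_sub_H2 qB) p0 gq).
apply: (@fixes_infty_of_lines w _ 0 w 1) => // x x0w.
have xB : pentagon w (x, 1) by split=> //=; rewrite lexx andbT invf_le1// ler1n.
have x0 : H2 (x, 1 : R) by rewrite /H2/=.
apply: pentagon_boundary; first exact: hB.
move=> /(cosh_isometry_nbhs hi x0) hx.
have : (pentagon w)° (x, 1).
  apply: filterS (filterI hx (nbhs_cosh2_ball x0 ltr01)) => q [] hq [q0 _].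
  exact: hB'.
by move=> /pentagon_interior_lt1/=; rewrite ltxx.
Qed.

Lemma pentagon_edge_lines w e p : pentagon_edges w e -> e p ->
  H2 p /\ side_lines w p.
Proof.
have half : 0 < 2^-1 :> R by rewrite invr_gt0.
rewrite /H2 /side_lines /= => -[[[[->|->]|->]|->]|->] [pa pb] /=;
  (split; [try by rewrite pb|try by tauto]).
- by case/andP: pb => /(lt_le_trans half).
- by case/andP: pb => /(lt_le_trans half).
Qed.

Lemma shared_horizontal_edge w f g e (a b c : R) :
  cosh_isometry f -> cosh_isometry g -> pentagon_edges w e ->
  a < b -> 0 < c -> (forall x, a <= x <= b -> (f @` e) (g (x, c))) ->
  same_infty f g.
Proof.
move=> fi gi ew ab c0 fg.
apply: (@fixes_infty_of_lines w _ a b c) => //.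
  exact: cosh_isometry_comp (cosh_isometry_inv fi) gi.
move=> x /fg[q /(pentagon_edge_lines ew)[q0 ql] /= <-].
by rewrite H2_invV.
Qed.

Lemma pentagon_edgeP w e : 0 < w -> pentagon_edges w e ->
  (exists a b c : R, [/\ a < b, 0 < c & forall x, a <= x <= b -> e (x, c)]) \/
  exists x0 : R,
    pentagon_oriented_c_edge w e (x0, 1) (x0, 2^-1).
Proof.
move=> w0 [[[[->|->]|->]|->]|->].
- by left; exists 0, w, 1; split.
- by left; exists 0, (w / 2), 2^-1; split; rewrite ?divr_gt0 ?invr_gt0.
- left; exists (w / 2), w, 2^-1; split; rewrite ?invr_gt0//.
  by rewrite ltr_pdivrMr// ltr_pMr// ltr1n.
- by right; exists 0; left.
- by right; exists w; right.
Qed.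

(* The orientation matters here: the half-turn about the midpoint of a c-edge *)
(* preserves the edge but moves infinity.                                     *)
Lemma same_infty_of_c_edge f g (x0 x1 : R) :
  cosh_isometry f -> cosh_isometry g ->
  f (x0, 1) = g (x1, 1) -> f (x0, 2^-1) = g (x1, 2^-1) -> same_infty f g.
Proof.
move=> fi gi e1 e2.
have h1 (x : R) : H2 (x, 1 : R) by rewrite /H2/=.
have h2 (x : R) : H2 (x, 2^-1 : R) by rewrite /H2/= invr_gt0.
have [//|[xi [k [k0 hk]]]] :=
  horocycle_dichotomy (cosh_isometry_comp (cosh_isometry_inv fi) gi).
exfalso; have := hk _ (h1 x1); have := hk _ (h2 x1).
by rewrite /= -e1 -e2 !H2_invV//=; lra.
Qed.

(** If [E] is a horocyclic edge of either tile, that segment lies on the side lines of the other; if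
    it is a c-edge of both, the orientations match its endpoints. *)
Lemma shared_edge_same_infty w T T' E : 0 < w -> tile_edge w T E ->
  tile_edge w T' E ->
  (forall s t s' t', tile_oriented_c_edge w T E s t ->
     tile_oriented_c_edge w T' E s' t' -> s = s' /\ t = t') ->
  exists f g, [/\ cosh_isometry f, cosh_isometry g, T = f @` pentagon w,
    T' = g @` pentagon w & same_infty f g].
Proof.
move=> w0 [f [e [fi Tf ew Ef]]] [g [e' [gi Tg ew' Eg]]] or.
have fc := hyp_isometry_cosh fi; have gc := hyp_isometry_cosh gi.
exists f, g; split=> //.
have [[a [b [c [ab c0 ce']]]]|[x1 or1]] := pentagon_edgeP w0 ew'.
  apply: (shared_horizontal_edge fc gc ew ab c0) => x /ce' xe'.
  by rewrite -Ef Eg; exists (x, c).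
have [[a [b [c [ab c0 ce]]]]|[x0 or0]] := pentagon_edgeP w0 ew.
  apply: same_infty_sym => //.
  apply: (shared_horizontal_edge gc fc ew' ab c0) => x /ce xe.
  by rewrite -Eg Ef; exists (x, c).
have [||e1 e2] := or (f (x0, 1)) (f (x0, 2^-1)) (g (x1, 1)) (g (x1, 2^-1)).
- by exists f, e, (x0, 1), (x0, 2^-1).
- by exists g, e', (x1, 1), (x1, 2^-1).
exact: same_infty_of_c_edge e1 e2.
Qed.

End Pentagon.

(** * The common point at infinity *)

Section Tilings.
Context {R : realType}.
Variables (w : R) (TT : set (set (R * R))).
Hypothesis (w0 : 0 < w).
Implicit Types (p q z : R * R) (f g : R * R -> R * R) (T : set (R * R)).

Let B : set (R * R) := pentagon w.
Let center : R * R := (w / 2, 3 / 4).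

Lemma center_interior : B° center.
Proof.
have w1 := w0; by apply: pentagon_interior; apply/andP; split=> /=; lra.
Qed.

Lemma center_H2 : H2 center.
Proof. by rewrite /H2/=; lra. Qed.

Lemma pentagon_cosh2_le p : B p -> cosh2 center p <= 4 * (w ^+ 2 + 2).
Proof.
move=> [/andP[a1 a2] /andP[b1 b2]].
have p0 : 0 < p.2 by lra.
rewrite /cosh2/= ler_pdivrMr ?mulr_gt0//.
have d : (w / 2 - p.1) ^+ 2 <= w ^+ 2.
  rewrite -[X in X <= _]real_normK ?num_real// ler_pXn2r// ?nnegrE ?(ltW w0)//.
  by rewrite ler_norml; apply/andP; split; lra.
have e : p.2 ^+ 2 <= 1 by rewrite expr_le1// ltW.
apply: (@le_trans _ _ (w ^+ 2 + 2)); first by rewrite (_ : (3 / 4) ^+ 2 = 9 / 16); [lra|field].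
rewrite -mulrA mulrCA -[leLHS]mulr1 ler_pM2l; first by lra.
by rewrite ltr_wpDl ?sqr_ge0.
Qed.

Lemma pentagon_closed : closed B.
Proof.
rewrite (_ : B = fst @^-1` `[0, w] `&` snd @^-1` `[2^-1, 1]); last first.
  by apply/seteqP; split=> p /=; rewrite !in_itv.
apply: closedI; apply: preimage_closed; try exact: itv_closed.
- by move=> p _; exact: cvg_fst.
- by move=> p _; exact: cvg_snd.
Qed.

Lemma nbhs_notin_tile f z : cosh_isometry f -> H2 z -> ~ (f @` B) z ->
  nbhs z (~` (f @` B)).
Proof.
move=> fi z0 nz; have [_ fs _] := fi.
have [p p0 fp] := fs _ z0.
have nB : (~` B `&` H2)° p.
  apply: filterI; last first.
    by apply: filterS (nbhs_cosh2_ball p0 ltr01) => q [].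
  apply: open_nbhs_nbhs; split; first exact/closed_openC/pentagon_closed.
  by move=> pB; apply: nz; exists p.
have := cosh_isometry_interior fi p0 nB; rewrite fp; apply: filterS.
move=> _ [q [nq q0] <-] [r rB /(cosh_isometry_inj fi) rq].
by apply: nq; rewrite -rq//; exact: pentagon_sub_H2 rB.
Qed.

Hypothesis tiling : tiling_by_pentagons w TT.

Lemma tile_isometry T : TT T -> exists f, cosh_isometry f /\ T = f @` B.
Proof.
have [tP _ _] := tiling; move=> /tP[f [fi ->]].
by exists f; split=> //; exact: hyp_isometry_cosh.
Qed.

Lemma tile_sub_H2 T : TT T -> T `<=` H2.
Proof.
have [_ cover _] := tiling; move=> TTT p Tp.
by rewrite -cover; exists T.
Qed.

(** Each tile contains a ball of fixed radius about its centre. As interiors are disjoint the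
    centres are uniformly separated, and those of tiles meeting a ball lie in a larger ball. *)
Lemma tiling_locally_finite z (K : R) : H2 z ->
  finite_set [set T | TT T /\ exists2 q, T q & cosh2 z q <= K].
Proof.
move=> z0; have [_ _ disj] := tiling.
have [e e0 eB] := cosh2_ball_sub center_H2 (nbhs_interior center_interior).
have /choice[F FP] : forall T, exists f, TT T -> cosh_isometry f /\ T = f @` B.
  move=> T; have [/tile_isometry[f fP]|nT] := pselect (TT T).
    by exists f.
  by exists idfun.
have cH f : cosh_isometry f -> H2 (f center).
  by move=> [fH _ _]; exact/fH/center_H2.
apply: (finite_cosh2_separated (m := fun T => F T center) (e := e)
  (K := K * (4 * (w ^+ 2 + 2))) z0 e0).
  move=> T [TTT [q Tq zq]]; have [fi TE] := FP _ TTT; split; first exact: cH.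
  have q0 := tile_sub_H2 TTT Tq.
  have [K0 _ _ _] := cosh2_le_bounds z0 q0 zq.
  apply: le_trans (cosh2_triangle z0 q0 (cH _ fi)) _.
  have cosh2_ge0 x y : H2 x -> H2 y -> 0 <= cosh2 x y.
    by move=> x0 y0; rewrite /cosh2 divr_ge0 ?addr_ge0 ?sqr_ge0// ltW// mulr_gt0.
  have fc0 := cH _ fi.
  apply: ler_pM => //; [exact: cosh2_ge0|exact: cosh2_ge0|].
  move: Tq; rewrite {1}TE => -[p pB <-]; have [_ _ fc] := fi.
  have p0 := pentagon_sub_H2 pB.
  by rewrite cosh2C (fc _ _ center_H2 p0); exact: pentagon_cosh2_le.
move=> T T' [TTT _] [TTT' _] near; apply: contrapT => TT'.
have [fi TE] := FP _ TTT; have [gi TE'] := FP _ TTT'.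
have : (T° `&` T'°) (F T' center); last by rewrite disj.
split; last first.
  by rewrite {1}TE'; apply: cosh_isometry_interior center_interior => //; exact: center_H2.
have [_ fs fc] := fi; have [p p0 fp] := fs _ (cH _ gi).
rewrite {1}TE -fp; apply: cosh_isometry_interior => //; apply: eB => //.
by rewrite -fc//; [rewrite fp|exact: center_H2].
Qed.

Lemma nbhs_notin_subtiling (S : set (set (R * R))) z : S `<=` TT -> H2 z ->
  (* Any bound above 2, the value of [cosh2 z z], gives a neighbourhood of [z]; only the finitely
     many tiles meeting it have to be avoided. *)
  ~ (\bigcup_(T in S) T) z -> nbhs z (~` \bigcup_(T in S) T).
Proof.
move=> STT z0 nz; have := tiling_locally_finite 3 z0.
move=> /finite_fsetP[X XE].
have near : nbhs z (fun q => forall T, T \in X -> S T -> ~ T q).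
  have := @filter_bigI _ _ X (fun T q => S T -> ~ T q) (nbhs z) (nbhs_filter z).
  move=> h; apply: filterS (h _) => [q /= hq T TX|T TX]; first exact: hq.
  have [ST|nST] := pselect (S T); last by apply: filterS filterT.
  have [f [fi TE]] := tile_isometry (STT _ ST).
  have := @nbhs_notin_tile f z fi z0; rewrite -TE => h'.
  by apply: filterS (h' _) => // Tz; apply: nz; exists T.
apply: filterS (filterI near (nbhs_cosh2_ball z0 ltr01)) => q [nq [q0 zq]].
move=> [T ST Tq]; apply: (nq T) => //.
have : [set` X] T; last by [].
rewrite -XE; split; first exact: STT.
by exists q => //; rewrite (le_trans (ltW zq))//; lra.
Qed.

Lemma tiling_countable : countable TT.
Proof.
have i0 : H2 ((0, 1) : R * R) by rewrite /H2/= ltr01.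
apply: (@sub_countable _ _ _ (\bigcup_(n in [set: nat])
  [set T | TT T /\ exists2 q, T q & cosh2 (0, 1) q <= n%:R])).
  apply: subset_card_le => T TTT.
  have [f [_ TE]] := tile_isometry TTT.
  have Tc : T (f center).
    by rewrite TE; exists center => //; exact: interior_subset center_interior.
  exists (Num.truncn (cosh2 (0, 1) (f center))).+1 => //; split=> //.
  exists (f center) => //; have [c0|c0] := ltP (cosh2 (0, 1) (f center)) 0.
    exact: le_trans (ltW c0) _.
  by have /andP[_ /ltW] := truncn_itv c0.
apply: bigcup_countable => // n _.
exact/finite_set_countable/tiling_locally_finite.
Qed.

Lemma countable_vertices :
  countable [set v | exists T T', [/\ TT T, TT T' & T `&` T' = [set v]]].
Proof.
apply: (@sub_countable _ _ _ ((fun P : set (R * R) * set (R * R) =>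
  xget (0 : R * R) (P.1 `&` P.2)) @` (TT `*` TT))).
  apply: subset_card_le => v [T [T' [TTT TTT' TT'v]]].
  by exists (T, T') => //=; rewrite TT'v; apply: xget_unique => // u ->.
apply: sub_countable (card_image_le _ _) _.
exact: countableX tiling_countable tiling_countable.
Qed.

(* A segment from one tile to another may be moved off the vertices, of which *)
(* there are countably many: then it stays in the union of the tiles whose    *)
(* frames have the same point at infinity, as it crosses from one tile to     *)
(* another inside a common edge.                                              *)
Lemma all_tiles_same_infty f0 : edge_to_edge w TT -> respects_orientations w TT ->
  cosh_isometry f0 -> TT (f0 @` B) ->
  forall T, TT T -> exists f, [/\ cosh_isometry f, T = f @` B & same_infty f0 f].
Proof.
move=> ee or f0i TT0 T1 TT1.
pose good T := exists f, [/\ cosh_isometry f, T = f @` B & same_infty f0 f].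
apply: contrapT => bad1.
have bad1' : ~ good T1 by [].
have [_ cover disj] := tiling.
have [f1 [f1i T1E]] := tile_isometry TT1.
have good0 : good (f0 @` B).
  exists f0; split=> //; exists 1 => // p p0.
  by rewrite /= H2_invV// mul1r.
pose p0 := f0 center; pose p1 := f1 center.
have p0i : (f0 @` B)° p0.
  exact: cosh_isometry_interior f0i center_H2 center_interior.
have p1i : T1° p1.
  by rewrite T1E; exact: cosh_isometry_interior f1i center_H2 center_interior.
have p01 : p0 <> p1.
  move=> p01; have : ((f0 @` B)° `&` T1°) p0 by split=> //; rewrite p01.
  by rewrite disj// => T01; apply: bad1'; rewrite -T01.
pose d1 := p1.1 - p0.1; pose d2 := p1.2 - p0.2.
pose n2 := d1 ^+ 2 + d2 ^+ 2.
have n20 : n2 != 0.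
  rewrite /n2 paddr_eq0 ?sqr_ge0// !sqrf_eq0 !subr_eq0.
  apply/negP => /andP[/eqP e1 /eqP e2]; apply: p01.
  by rewrite [LHS]surjective_pairing -e1 -e2 -surjective_pairing.
(* The segment from [p0] to [p1], translated in the normal direction by [del]; [phi] recovers [del],
   so each vertex rules out only one offset. *)
pose gam (del t : R) := (p0.1 - del * d2 + t * d1, p0.2 + del * d1 + t * d2).
pose phi p := ((p.2 - p0.2) * d1 - (p.1 - p0.1) * d2) / n2.
have phiE del t : phi (gam del t) = del.
  rewrite /phi /gam/=; apply: (mulIf n20); rewrite divfK// /n2; ring.
have [e0 /= e00 e0T] : nbhs_ball p0 (f0 @` B) by exact/nbhs_ballP.
have [e1 /= e10 e1T] : nbhs_ball p1 T1 by exact/nbhs_ballP.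
pose e := Num.min e0 e1; have e_gt0 : 0 < e by rewrite lt_min e00.
pose D := 1 + `|d1| + `|d2|.
have D0 : 0 < D by rewrite /D -addrA ltr_wpDr// addr_ge0.
have small del (d : R) : 0 <= del <= e / D / 2 -> `|d| <= D -> `|del * d| < e.
  move=> /andP[del0 dele] dD; rewrite normrM (ger0_norm del0).
  apply: (@le_lt_trans _ _ (e / 2)); last by lra.
  apply: (@le_trans _ _ (e / D / 2 * D)); first exact: ler_pM.
  by rewrite mulrAC divfK ?gt_eqF.
have d1D : `|d1| <= D.
  by rewrite /D -addrA addrCA lerDl addr_ge0.
have d2D : `|d2| <= D.
  by rewrite /D lerDr addr_ge0.
pose V := [set v | exists T T', [/\ TT T, TT T' & T `&` T' = [set v]]].
(* An interval of offsets is uncountable; those up to [e / D / 2] keep both ends in their tiles. *)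
have [del [del0 delV]] : exists del, 0 <= del <= e / D / 2 /\ ~ (phi @` V) del.
  apply: contrapT => no; apply: (@uncountable_segment R 0 (e / D / 2)).
    by rewrite !divr_gt0.
  apply: (@sub_countable _ _ _ (phi @` V)); last first.
    apply: sub_countable (card_image_le _ _) _; exact: countable_vertices.
  apply: subset_card_le => del; rewrite /= in_itv/= => del0.
  by apply: contrapT => delV; apply: no; exists del.
have gT0 : (f0 @` B) (gam del 0).
  apply: e0T; rewrite /gam; split; rewrite /ball/=.
    rewrite mul0r addr0 opprB addrCA subrr addr0.
    by apply: lt_le_trans (small _ _ del0 d2D) _; rewrite ge_min lexx.
  rewrite mul0r addr0 opprD addNKr normrN.
  by apply: lt_le_trans (small _ _ del0 d1D) _; rewrite ge_min lexx.
have gT1 : T1 (gam del 1).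
  apply: e1T; rewrite /gam; split; rewrite /ball/=.
    rewrite (_ : _ - _ = del * d2); last by rewrite /d1; ring.
    by apply: lt_le_trans (small _ _ del0 d2D) _; rewrite ge_min lexx orbT.
  rewrite (_ : _ - _ = - (del * d1)) ?normrN; last by rewrite /d2; ring.
  by apply: lt_le_trans (small _ _ del0 d1D) _; rewrite ge_min lexx orbT.
have gH t : 0 <= t <= 1 -> H2 (gam del t).
  move=> /andP[t0 t1].
  have := tile_sub_H2 TT0 gT0; have := tile_sub_H2 TT1 gT1.
  rewrite /H2/= mul1r mul0r addr0; set y := p0.2 + _ => y1 y0.
  rewrite (_ : y + t * d2 = (1 - t) * y + t * (y + d2)); last by ring.
  have [->|tn1] := eqVneq t 1; first by rewrite subrr mul0r add0r mul1r.
  rewrite ltr_pwDl ?mulr_ge0 ?(ltW y1)// mulr_gt0// subr_gt0.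
  by rewrite lt_neqAle tn1.
pose U := \bigcup_(T in [set T | TT T /\ good T]) T.
pose W := \bigcup_(T in [set T | TT T /\ ~ good T]) T.
have UW t : U (gam del t) -> W (gam del t) -> False.
  move=> [T [TTT gT] Tg] [T' [TTT' bT'] Tg'].
  have TT' : T <> T' by move=> TE; apply: bT'; rewrite -TE.
  have TT'0 : T `&` T' !=set0 by exists (gam del t).
  have [[E [ET ET' _]]|[v [_ _ TT'v]]] := ee _ _ TTT TTT' TT' TT'0; last first.
    have gv : gam del t = v by have : (T `&` T') (gam del t) by []; rewrite TT'v.
    by apply: delV; exists v; [exists T, T'|rewrite -gv phiE].
  have [f [g [fi gi TE TE' fg]]] :=
    shared_edge_same_infty w0 ET ET' (or _ _ TTT TTT' TT' E).
  apply: bT'; exists g; split=> //.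
  have [f' [f'i TE2 f0f']] := gT.
  apply: (same_infty_trans f0i f'i gi f0f').
  apply: (same_infty_trans f'i fi gi) fg.
  by apply: (same_tile_same_infty w0 f'i fi); rewrite -TE2.
have UWcover t : 0 <= t <= 1 -> U (gam del t) \/ W (gam del t).
  move=> /gH; rewrite -cover => -[T TTT Tg].
  by have [gT|bT] := pselect (good T); [left|right]; exists T.
have cgam : continuous (gam del).
  have aff (a b t : R) : (fun u => a + u * b) @ t --> a + t * b.
    by apply: cvgD; [exact: cvg_cst|apply: cvgM; [exact: cvg_id|exact: cvg_cst]].
  by move=> t; exact: (cvg_pair (aff _ _ t) (aff _ _ t)).
have US : [set T | TT T /\ good T] `<=` TT by move=> T [].
have WS : [set T | TT T /\ ~ good T] `<=` TT by move=> T [].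
have nU t : 0 <= t <= 1 -> ~ U (gam del t) -> (~` (gam del @^-1` U))° t.
  move=> /gH gt nUt.
  exact: (cgam t _ (nbhs_notin_subtiling US gt nUt)).
have nW t : 0 <= t <= 1 -> ~ W (gam del t) -> (~` (gam del @^-1` W))° t.
  move=> /gH gt nWt.
  exact: (cgam t _ (nbhs_notin_subtiling WS gt nWt)).
(* The parameters in good tiles and those in bad ones are closed, disjoint and cover [0, 1]; by
   connectedness the good ones are everything, including the end in [T1]. *)
have /seteqP[_ /(_ 1)] : `[0, 1]%classic `&` gam del @^-1` U = `[0, 1]%classic.
  apply: segment_connected.
  - exists 0; split; first by rewrite /= in_itv/= lexx ler01.
    by exists (f0 @` B).
  - exists (~` (gam del @^-1` W))°; first exact: open_interior.
    apply/seteqP; split=> t [] /=; rewrite in_itv/= => t01.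
      by move=> Ut; split=> //; apply: nW => // /(UW _ Ut).
    move=> /interior_subset nWt; split=> //.
    by have [] := UWcover _ t01.
  - exists (~` (~` (gam del @^-1` U))°); first exact/open_closedC/open_interior.
    apply/seteqP; split=> t [] /=; rewrite in_itv/= => t01.
      by move=> Ut; split=> // /interior_subset; exact.
    by move=> nI; split=> //; apply: contrapT => /(nU _ t01).
rewrite /= in_itv/= lexx ler01 => /(_ isT)[_ U1].
by apply: (UW 1) => //; exists T1.
Qed.

End Tilings.

(** * Symmetries *)

Section SymmetryGroup.
Context {R : realType}.
Implicit Types (p q z : R * R) (f g h : R * R -> R * R).

Lemma hyp_isometry_comp f g : hyp_isometry f -> hyp_isometry g ->
  hyp_isometry (f \o g).
Proof.
move=> [fb fd] [gb gd]; split; first exact: set_bij_comp gb fb.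
have [gH _ _] := gb.
by move=> p q p0 q0; rewrite /= fd ?gd//; exact: gH.
Qed.

Lemma hyp_isometry_inv f : hyp_isometry f -> hyp_isometry (H2_inv f).
Proof.
move=> fi; have fc := hyp_isometry_cosh fi; have [fb fd] := fi.
have [fH _ _] := fc.
split.
  split.
  - by move=> q /(H2_invK fc)[].
  - move=> p q /set_mem/(H2_invK fc)[_ fp] /set_mem/(H2_invK fc)[_ fq] pq.
    by rewrite -fp -fq pq.
  - by move=> p p0; exists (f p); [exact: fH|exact: H2_invV].
move=> p q p0 q0; have [p1 {2}<-] := H2_invK fc p0.
by have [q1 {2}<-] := H2_invK fc q0; rewrite fd.
Qed.

Variable TT : set (set (R * R)).
Hypothesis TT_sub : forall T, TT T -> T `<=` H2.

Let G := symmetry_group TT.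

Lemma symmetry_image g T : G g -> TT T -> TT (g @` T).
Proof. by move=> [_ gTT] TTT; rewrite -gTT; exists T. Qed.

Lemma symmetry_comp f g : G f -> G g -> G (f \o g).
Proof.
move=> Gf Gg; have [fi fTT] := Gf; have [gi gTT] := Gg.
split; first exact: hyp_isometry_comp.
apply/seteqP; split=> [_ [T TTT <-]|T].
  by rewrite -image_comp; do 2!apply: symmetry_image => //.
rewrite -{1}fTT => -[T' + <-]; rewrite -{1}gTT => -[T'' TTT'' <-].
by exists T''; rewrite // image_comp.
Qed.

Lemma symmetry_inv g : G g -> G (H2_inv g).
Proof.
move=> [gi gTT]; split; first exact: hyp_isometry_inv.
have gc := hyp_isometry_cosh gi.
have gK T : TT T -> H2_inv g @` (g @` T) = T.
  move=> /TT_sub TH; apply/seteqP; split=> [_ [_ [p Tp <-] <-]|p Tp].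
    by rewrite H2_invV//; exact: TH.
  by exists (g p); [exists p|rewrite H2_invV//; exact: TH].
apply/seteqP; split=> [_ [T + <-]|T TTT].
  by rewrite -{1}gTT => -[T' TTT' <-]; rewrite gK.
by exists (g @` T); [rewrite -gTT; exists T|exact: gK].
Qed.

(** In the coordinates given by the frame [f0], the map [g] is a similarity; the conjugation is
    written without an inverse. *)
Definition acts_as f0 g (s t : R) : Prop :=
  forall p, H2 p -> g (f0 p) = f0 (similarity s t p).

Lemma acts_as_comp f0 g h (s t s' t' : R) : s' != 0 ->
  acts_as f0 g s t -> acts_as f0 h s' t' -> acts_as f0 (g \o h) (s * s') (s * t' + t).
Proof.
move=> s0 gP hP p p0; rewrite /= hP// gP; last first.
  by have [+ _ _] := similarity_cosh_isometry t' s0; exact.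
by congr f0; rewrite /similarity/= normrM !mulrDr !mulrA addrA.
Qed.

Lemma acts_as_inv f0 g (s t : R) : cosh_isometry f0 -> cosh_isometry g -> s != 0 ->
  acts_as f0 g s t -> acts_as f0 (H2_inv g) s^-1 (- (t / s)).
Proof.
move=> fi gi s0 gP p p0.
have [sH _ _] := similarity_cosh_isometry (- (t / s)) (invr_neq0 s0).
have [fH _ _] := fi.
have -> : f0 p = g (f0 (similarity s^-1 (- (t / s)) p)).
  rewrite gP; last exact: sH.
  congr f0; rewrite /similarity/= [LHS]surjective_pairing normfV.
  by congr pair; field; rewrite ?normr_eq0.
by rewrite H2_invV//; exact/fH/sH.
Qed.

End SymmetryGroup.

(** * Contractions and the contradiction with compactness *)

Section Crystallographic.
Context {R : realType}.
Variables (w : R) (TT : set (set (R * R))).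
Hypotheses (w0 : 0 < w) (hTT : B_tiling w TT).
Implicit Types (p q z : R * R) (f g h : R * R -> R * R).

Let tiling : tiling_by_pentagons w TT. Proof. by case: hTT. Qed.
Let G := symmetry_group TT.

Variable f0 : R * R -> R * R.
Hypotheses (f0i : cosh_isometry f0) (TT0 : TT (f0 @` pentagon w)).

(** The image of the base tile is a tile with frame [g \o f0]; it shares its ideal point with the
    base tile, so [g] read in the frame [f0] fixes infinity. *)
Lemma symmetry_acts_as g : G g -> exists s t, s != 0 /\ acts_as f0 g s t.
Proof.
move=> Gg; have gi := hyp_isometry_cosh Gg.1.
have [_ ee or] := hTT.
have [f [fi TE f0f]] := all_tiles_same_infty w0 tiling ee or f0i TT0
  (symmetry_image Gg TT0).
have gf0i := cosh_isometry_comp gi f0i.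
have fgf0 : same_infty f (g \o f0).
  by apply: (same_tile_same_infty w0 fi gf0i); rewrite -TE image_comp.
have f0gf0 := same_infty_trans f0i fi gf0i f0f fgf0.
have f0'i := cosh_isometry_inv f0i.
have [s [t [s0 stP]]] :=
  fixes_infty_similarity (cosh_isometry_comp f0'i gf0i) f0gf0.
exists s, t; split=> // p p0; rewrite -stP//=.
have [gfH _ _] := gf0i.
by have [_ ->] := H2_invK f0i (gfH _ p0).
Qed.

(** The corner (0, 1) has the least abscissa in the pentagon. Locating its image under each map in
    the image of the other gives [t - t'] and [t' - t] as [s] times non-negative numbers, so both
    vanish. *)
Lemma acts_as_image_inj g h (s t t' : R) : s != 0 ->
  acts_as f0 g s t -> acts_as f0 h s t' ->
  g @` (f0 @` pentagon w) = h @` (f0 @` pentagon w) -> t = t'.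
Proof.
move=> s0 gP hP gh.
have cB : pentagon w (0, 1).
  by split=> /=; rewrite ?lexx ?(ltW w0)//= invf_le1// ler1n.
have key u v (a b : R) : acts_as f0 u s a -> acts_as f0 v s b ->
    u @` (f0 @` pentagon w) = v @` (f0 @` pentagon w) ->
    exists2 x, 0 <= x & a = s * x + b.
  move=> uP vP uv.
  have : (u @` (f0 @` pentagon w)) (u (f0 (0, 1))).
    by exists (f0 (0, 1)) => //; exists (0, 1).
  rewrite uv => -[_ [p pB <-]].
  have p0 := pentagon_sub_H2 pB; have c0 := pentagon_sub_H2 cB.
  have [aH _ _] := similarity_cosh_isometry a s0.
  have [bH _ _] := similarity_cosh_isometry b s0.
  rewrite uP// vP// => /(cosh_isometry_inj f0i (bH _ p0) (aH _ c0))[] e1 _.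
  exists p.1; first by case: pB => /andP[].
  by rewrite e1 mulr0 add0r.
have [x x0 tE] := key _ _ _ _ gP hP gh.
have [y y0 t'E] := key _ _ _ _ hP gP (esym gh).
have xy : s * (x + y) = 0 by rewrite mulrDr; lra.
have xy0 : x + y = 0 by apply: (mulfI s0); rewrite xy mulr0.
have x0E : x = 0 by lra.
by rewrite tE x0E mulr0 add0r.
Qed.

Lemma expr_inj_small (a : R) : a != 0 -> `|a| < 1 -> injective (fun k => a ^+ k).
Proof.
move=> a0 a1.
have lt k l : (k < l)%N -> a ^+ k <> a ^+ l.
  move=> kl; rewrite -(subnKC (ltnW kl)) exprD -{1}[a ^+ k]mulr1.
  move=> /(mulfI (expf_neq0 k a0))/(congr1 Num.norm); rewrite normrX normr1.
  move=> /eqP; rewrite eq_sym lt_eqF// exprn_ilt1// -lt0n subn_gt0.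
  by [].
move=> k l kl; case: (ltngtP k l) => // /lt; [by move/(_ kl)|by move/(_ (esym kl))].
Qed.

(* The conjugates of [h] by the powers of the contraction [a] move a tile     *)
(* within a bounded region, so two of them agree.                             *)
Lemma symmetries_fix_center a h (al xa s t : R) : G a -> G h ->
  al != 0 -> `|al| < 1 -> s != 0 -> acts_as f0 a al ((1 - al) * xa) ->
  acts_as f0 h s t -> s * xa + t = xa.
Proof.
move=> Ga Gh al0 al1 s0 aP hP; pose d := s * xa + t - xa.
have TTH := @tile_sub_H2 _ w TT tiling.
have ai := hyp_isometry_cosh Ga.1.
(* The map [g k] is [h] conjugated by the [k]-th power of [a]: it displaces the centre [xa] by
   [al ^+ k * d], where [d] is the displacement by [h]. *)
have /choice[g gP] : forall k, exists g, G g /\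
    acts_as f0 g s ((1 - s) * xa + al ^+ k * d).
  elim=> [|k [g [Gg gP]]].
    exists h; split=> //; rewrite expr0 mul1r.
    by rewrite (_ : _ + _ = t)// /d; ring.
  exists (a \o (g \o H2_inv a)); split.
    by do 2!apply: symmetry_comp => //; exact: symmetry_inv.
  have aVP := acts_as_inv f0i ai al0 aP.
  have := acts_as_comp (mulf_neq0 s0 (invr_neq0 al0)) aP
    (acts_as_comp (invr_neq0 al0) gP aVP).
  rewrite (_ : al * (s / al) = s); last by field.
  rewrite (_ : al * _ + _ = (1 - s) * xa + al ^+ k.+1 * d)//.
  by rewrite exprS; field.
suff d0 : d = 0 by apply/eqP; rewrite -subr_eq0; exact/eqP.
apply: contrapT => /eqP d0.
(* Bounds [cosh2] between (0, 1) and its image under every conjugate, since the powers of [al] are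
   at most 1 in absolute value. *)
pose K := ((`|(1 - s) * xa| + `|d|) ^+ 2 + 1 + `|s| ^+ 2) / `|s|.
have i0 : H2 ((0, 1) : R * R) by rewrite /H2/= ltr01.
have [f0H _ f0c] := f0i.
apply: infinite_nat.
apply: (finite_inj_sub (f := fun k => g k @` (f0 @` pentagon w)))
  (tiling_locally_finite w0 tiling K (f0H _ i0)).
  move=> k l _ _ kl; have [_ gk] := gP k; have [_ gl] := gP l.
  have /addrI/(mulIf d0) := acts_as_image_inj s0 gk gl kl.
  exact: expr_inj_small.
move=> _ [k _ <-]; have [Gk gk] := gP k; split; first exact: symmetry_image.
exists (g k (f0 (0, 1))).
  exists (f0 (0, 1)) => //; exists (0, 1) => //.
  by split=> /=; rewrite ?lexx ?(ltW w0)//= invf_le1// ler1n.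
have [sH _ _] := similarity_cosh_isometry ((1 - s) * xa + al ^+ k * d) s0.
rewrite gk// f0c//; last exact: sH.
rewrite /cosh2 /similarity/= mulr0 !add0r sqrrN mulr1 mul1r expr1n.
rewrite /K ler_pM2r ?invr_gt0 ?normr_gt0// !lerD2r.
rewrite -real_normK ?num_real// ler_pXn2r// ?nnegrE ?addr_ge0//.
apply: (le_trans (ler_normD _ _)); rewrite lerD2l normrM normrX.
by rewrite ler_piMl// exprn_ile1// ltW.
Qed.

Lemma compact_cosh2_bounded (F : set (R * R)) z : compact F -> F `<=` H2 ->
  exists K, forall q, F q -> cosh2 z q <= K.
Proof.
move=> Fc FH; have [z0|z0] := eqVneq z.2 0.
  by exists 0 => q _; rewrite /cosh2 z0 mul0r invr0 mulr0.
have cont : {within F, continuous (cosh2 z)}.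
  apply: continuous_in_subspaceT => q; rewrite inE => /FH q0.
  apply: cvgM.
    apply: cvgD; last by apply: cvg_sqr; exact: cvg_snd.
    apply: cvgD; last exact: cvg_cst.
    by apply: cvg_sqr; apply: cvgB; [exact: cvg_cst|exact: cvg_fst].
  apply: cvgV; first by rewrite mulf_neq0// gt_eqF.
  by apply: cvgM; [exact: cvg_cst|exact: cvg_snd].
have [M [_ bM]] := compact_bounded (continuous_compact cont Fc).
exists (M + 1) => q Fq.
by apply: le_trans (ler_norm _) (bM (M + 1) _ _ _); [rewrite ltrDl|exists q].
Qed.

Lemma not_crystallographic : ~ crystallographic TT.
Proof.
move=> [F [[FH _ cover _] Fc]].
have i0 : H2 ((0, 1) : R * R) by rewrite /H2/= ltr01.
have [f0H f0s f0c] := f0i.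
have [K FK] := compact_cosh2_bounded (f0 (0, 1)) Fc FH.
(* In the frame [f0], every point is the image under a symmetry of a point [r] in a fixed ball about
   (0, 1). *)
have orbit p : H2 p -> exists g s t r, [/\ G g, s != 0, acts_as f0 g s t,
    H2 r /\ cosh2 (0, 1) r <= K & p = similarity s t r].
  move=> p0; have := f0H _ p0; rewrite -{1}cover => -[g Gg [q Fq gq]].
  have [s [t [s0 gP]]] := symmetry_acts_as Gg.
  have [r r0 fr] := f0s _ (FH _ Fq).
  have [sH _ _] := similarity_cosh_isometry t s0.
  exists g, s, t, r; split=> //.
    by split=> //; rewrite -(f0c _ _ i0 r0) fr; exact: FK.
  by apply: (cosh_isometry_inj f0i p0 (sH _ r0)); rewrite -gP// fr.
have [_ [_ [_ [r [_ _ _ [r0 rK] _]]]]] := orbit _ i0.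
have [K0 _ _ _] := cosh2_le_bounds i0 r0 rK.
(* Points of the ball have height at least [K^-1], so reaching height [(2 * K)^-1] takes a factor of
   at most 1/2: this yields the contraction. *)
have K1 : H2 ((0, (2 * K)^-1) : R * R) by rewrite /H2/= invr_gt0 mulr_gt0.
have [a [al [ta [q [Ga al0 aP [q0 qK] [_ qE]]]]]] := orbit _ K1.
have [_ _ q1 _] := cosh2_le_bounds i0 q0 qK.
have al1 : `|al| <= 2^-1.
  rewrite /= in q1.
  have : `|al| * 1 <= `|al| * (K * q.2) by rewrite ler_wpM2l.
  rewrite mulr1 mulrCA -qE => /le_trans; apply.
  by rewrite invfM mulrCA divff ?gt_eqF// mulr1.
have al1' : `|al| < 1 by apply: le_lt_trans al1 _; lra.
have al11 : 1 - al != 0.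
  by rewrite subr_eq0; apply/eqP => e; move: al1'; rewrite -e normr1 ltxx.
pose xa := ta / (1 - al).
have taE : ta = (1 - al) * xa by rewrite mulrC divfK.
rewrite taE in aP.
(* A symmetry reaching (xa + L, 1) fixes [xa], so [L = s * (u.1 - xa)]. Height 1 forces [|s| <= K],
   and [|u.1 - xa|] is at most the second factor; the added 1 exceeds this bound. *)
pose L := K * (K + `|xa|) + 1.
have L0 : H2 ((xa + L, 1) : R * R) by rewrite /H2/= ltr01.
have [h [s [t [u [Gh s0 hP [u0 uK] [e1 e2]]]]]] := orbit _ L0.
have [_ _ u1 u2] := cosh2_le_bounds i0 u0 uK.
have fx := symmetries_fix_center Ga Gh al0 al1' s0 aP hP.
have LE : L = s * (u.1 - xa) by rewrite mulrBr; lra.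
have sK : `|s| <= K.
  have : `|s| * 1 <= `|s| * (K * u.2) by rewrite ler_wpM2l.
  by rewrite mulr1 mulrCA -e2 mulr1.
have uxa : `|u.1 - xa| <= K + `|xa|.
  apply: le_trans (ler_normB _ _) _; rewrite lerD2r.
  by move: u2; rewrite /= sub0r normrN mulr1.
have : L <= K * (K + `|xa|).
  apply: le_trans (ler_norm _) _; rewrite LE normrM.
  by apply: ler_pM.
by rewrite /L; lra.
Qed.

End Crystallographic.

Theorem theorem3p4 (R : realType) (w : R) (hw : 0 < w)
    (TT : set (set (R * R))) (hTT : B_tiling w TT) :
  ~ crystallographic TT.
Proof.
have [tiling _ _] := hTT; have [_ cover _] := tiling.
have : H2 ((0, 1) : R * R) by rewrite /H2/= ltr01.
rewrite -cover => -[T TTT _].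
have [f [fi TE]] := tile_isometry tiling TTT.
by apply: (not_crystallographic hw hTT fi); rewrite -TE.
Qed.
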